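(* Let $g\geq0$ be an integer, and let $\lambda,\mu$ be two partitions such that $|\lambda|=|\mu|$. Let $s,t$ be two non-negative integers satisfying $2s+t=l(\lambda)+l(\mu)+2g-2$. Assume that $2s+t>0$ and $\{\lambda,\mu\}\not\subset\{(2k),(k,k)\}$. Then, for any $(s,t)$-tuple $\Lambda_{s,t}$, we have the inequality $$Z_g(\lambda,\mu;s,t)\leq Z_g(\lambda,\mu;\Lambda_{s,t})$$ between the proper zigzag number $Z_g(\lambda,\mu;s,t)$ and the generalized zigzag number $Z_g(\lambda,\mu;\Lambda_{s,t})$.
   Context: **Conventions.** Partitions are unordered; $l(\lambda)$ is the number of entries and $|\lambda|$ the sum of the entries of $\lambda$. The condition $\{\lambda,\mu\}\not\subset\{(2k),(k,k)\}$ is meant for every positive integer $k$. **Tropical covers.** A tropical curve $C$ is a connected metric graph all of whose vertices have valence $1$ (leaves) or $3$ (inner vertices); edges incident to leaves are called ends and have infinite length, all other edges are inner edges and have finite length. The genus of $C$ is its first Betti number. An isomorphism of tropical curves is an isometric homeomorphism of the curves with leaves removed. Put $T\mathbb{P}^1=\mathbb{R}\cup\{\pm\infty\}$. An $(s,t)$-distribution $\underline z=\underline x\sqcup\underline y$ consists of a set $\underline x$ of $s$ pairs $x_i=(x'_{2i-1},x'_{2i})$ of real numbers with $x'_1<\dots<x'_{2s}$ and a set $\underline y$ of $t$ further real numbers, distinct from the $x'_j$ and not contained in any $[x'_{2i-1},x'_{2i}]$; its elements (pairs and points) are ordered along the real line as $z_1<\dots<z_{s+t}$. A tropical cover of type $(g,\lambda,\mu,\underline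 z)$ is a continuous map $\varphi:C\to T\mathbb{P}^1$ from a tropical curve of genus $g$ such that: the images of the inner vertices are exactly the $2s+t$ numbers $x'_j$ and $y\in\underline y$ (so $\varphi$ is a bijection from inner vertices to these numbers); leaves are mapped to $\{\pm\infty\}$; $\varphi$ is piecewise integer affine linear with slope $\omega(e)\in\mathbb{N}_{>0}$ (the weight) on each edge $e$; at each inner vertex, orienting edges in the direction in which $\varphi$ increases, the sum of the weights of incoming edges equals that of outgoing edges; the entries of $\lambda$ (resp. $\mu$) are the weights of the ends going to $-\infty$ (resp. $+\infty$). Edges are always oriented in this way and are called odd/even according to their weights. Covers $\varphi_1,\varphi_2$ are isomorphic if there is an isomorphism $\Phi:C_1\to C_2$ of tropical curves with $\varphi_2\circ\Phi=\varphi_1$. **Resolving covers.** A symmetric cycle (resp. symmetric fork) is a pair of inner edges of equal weight with the same two endpoints (resp. a pair of ends of equal weight adjacent to the same inner vertex). A tropical cover is resolving if for each $i=1,\dots,s$ the inner vertices $v,v'$ with $\varphi(v)=x'_{2i-1}$, $\varphi(v')=x'_{2i}$ are adjacent and one of the following holds (weights otherwise arbitrary subject to balancing): (A) $v$ has two incoming edges of equal weight $k$ and one outgoing edge (of weight $2k$) ending at $v'$, and $v'$ has one further incoming edge and one outgoing edge; (A') $v$ has one incoming and two outgoing edges, one of which has weight $2k$ and ends at $v'$, where it splits into two outgoing edges of equal weight $k$; in (A) and (A') the two weight-$k$ edges must form a symmetric fork or a symmetric cycle; (B) $v$ has one incoming and two outgoing edges, exactly one of the outgoing edges ends at $v'$,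 and $v'$ has one further incoming edge and one outgoing edge; (C) $v$ and $v'$ are joined by two edges, not both odd. The edge joining $v$ and $v'$ (both edges in case (C)) is called contractible; there are no other contractible edges. A symmetric cycle or fork is non-contractible if it contains no contractible edge. Notation: $\mathrm{Sym}(\varphi)$: all symmetric cycles and forks; $\mathrm{Symc}(\varphi)$: symmetric cycles; $\mathrm{Sym}_3(\varphi)$ (resp. $\mathrm{Sym}_2(\varphi)$): non-contractible symmetric cycles and forks adjacent (resp. not adjacent) to a contractible edge; $E_c(\varphi)$: even contractible edges; $\mathrm{Symc}_c(\varphi)$: contractible symmetric cycles; $\mathrm{Nsym}_c(\varphi)$: non-symmetric cycles consisting of two even contractible edges. **Generalized zigzag covers.** A resolving tropical cover $\varphi:C\to T\mathbb{P}^1$ is a generalized zigzag cover if there is a non-empty connected subgraph $S\subset C\setminus\mathrm{Sym}_2(\varphi)$ (i.e. $S$ contains no edge of a cycle or fork in $\mathrm{Sym}_2(\varphi)$) such that: (1) all contractible edges lie in $S$ and $S$ contains at least one inner vertex; (2) $S$ contains no even edges except even contractible ones; (3) every connected component of $C\setminus S$ is a tail of one of the following forms, attached to $S$ at one point, with $o$ odd and $e$ even: a symmetric fork of two ends of weight $o$ followed by a chain of $n\ge0$ symmetric cycles with edges of weight $o$, consecutive pieces and finally $S$ being connected by edges of weight $2o$; one end of weight $2o$ followed by a chain of $n\ge0$ symmetric cycles with edges of weight $o$, consecutive pieces and finally $S$ being connected by edges of weight $2o$; a symmetric fork of two ends of weight $e$ connected to $S$ by an edge of weight $2e$; a single end of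 weight $2e$ attached to $S$. **Effective colourings and multiplicity.** A colouring $\rho$ of $\varphi$ consists of a subset $I_\rho=I_\rho(\varphi)\subset\mathrm{Sym}(\varphi)$ and an assignment of red or blue to each connected component of the subgraph of even edges in $C\setminus I_\rho^\circ$. Each inner vertex has one edge on one side (incoming or outgoing) and two on the other. It is positive (and its image is positive) if: one odd edge is alone on its side and the other side has an odd edge and a blue even edge; or all three edges are blue; or the single edge is red and the other two are odd and not in $I_\rho$; or the single edge is blue and the other two form an element of (or are the two edges of a cycle in) $I_\rho$. It is negative in the same cases with red and blue interchanged. For $\varphi$ resolving, $\rho$ is effective if the two vertices over each pair $x_i$ have the same sign, $\mathrm{Sym}_3(\varphi)\subset I_\rho$ and $\mathrm{Symc}_c(\varphi)\cap I_\rho=\emptyset$. Then $$\mathrm{mult}^{\mathbb{R}}(\varphi,\rho)=\frac{2^{|E(I_\rho)\setminus E_c(\varphi)|+|\mathrm{Symc}(\varphi)\cap\mathrm{Sym}_3(\varphi)|+|\mathrm{Nsym}_c(\varphi)|}}{2^{|\mathrm{Sym}_2(\varphi)|}}\prod_{e\in\mathrm{Symc}(\varphi)\cap I_\rho}\omega(e),$$ where $E(I_\rho)$ is the set of even inner edges in $C\setminus I_\rho^\circ$ and $\omega(e)$ is the weight of either edge of the cycle $e$. **Generalized zigzag numbers.** An $(s,t)$-tuple $\Lambda_{s,t}=(\Lambda_1,\dots,\Lambda_{s+t})$ is a sequence of partitions of $d=|\lambda|$, $s$ of them equal to $(3,1,\dots,1)$ and $t$ equal to $(2,1,\dots,1)$.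 An $(s,t)$-distribution $\underline z$ is compatible with it if $z_i$ is a pair exactly when $\Lambda_i=(3,1,\dots,1)$. Let $\mathcal{Z}_g(\lambda,\mu;\Lambda_{s,t})$ be the set of isomorphism classes of generalized zigzag covers of type $(g,\lambda,\mu,\underline z)$, with $\underline z$ compatible with $\Lambda_{s,t}$, and $Z_g(\lambda,\mu;\Lambda_{s,t})=\sum_{[\varphi]\in\mathcal{Z}_g(\lambda,\mu;\Lambda_{s,t})}2^{m(\varphi)}$, where $m(\varphi)=0$ if $\mathrm{mult}^{\mathbb{R}}(\varphi,\rho)$ is odd for an effective colouring $\rho$ and $m(\varphi)=1$ otherwise (the parity does not depend on $\rho$). **Proper zigzag numbers.** Given $w_1<\dots<w_{2s+t}$ in $\mathbb{R}$, the trivial $(s,t)$-distribution is $\underline x=\{(w_1,w_2),\dots,(w_{2s-1},w_{2s})\}$, $\underline y=\{w_{2s+1},\dots,w_{2s+t}\}$. A generalized zigzag cover $\varphi:C\to T\mathbb{P}^1$ of type $(g,\lambda,\mu,\underline x\sqcup\underline y)$ for the trivial distribution is properly mixed if: (1) there is an odd inner edge $E_c\subset S$ such that $C\setminus E_c^\circ$ has two connected components, the inner vertices of one being mapped onto $\{w_1,\dots,w_{2s}\}$ and those of the other onto $\{w_{2s+1},\dots,w_{2s+t}\}$; (2) if $E_c$ is oriented from $v_1$ to $v_2$, there is a vertex $v_1'$ with $\varphi(v_1')=w_1$, $\varphi(v_1)=w_2$; (3) $(v_1',v_1)$ is of form (B): $v_1'$ has one odd incoming edge, one odd outgoing edge,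 and an even outgoing (contractible) edge ending at $v_1$; $v_1$ has a further odd incoming edge and an odd outgoing edge; moreover the two odd incoming edges (at $v_1'$ and at $v_1$) are ends of $C$ of the same weight; (4) $\varphi(v_2)=w_{2s+t}$ and $v_2$ has two odd incoming edges. $Z_g(\lambda,\mu;s,t)$ is the number of isomorphism classes of properly mixed generalized zigzag covers of type $(g,\lambda,\mu,\underline x\sqcup\underline y)$. *)

(* Defs.v *)
From mathcomp Require Import all_boot all_order all_algebra finmap.
From mathcomp Require Import boolp classical_sets functions cardinality fsbigop.
From mathcomp Require Import reals constructive_ereal.

Set Implicit Arguments.
Unset Strict Implicit.
Unset Printing Implicit Defensive.

Import Order.TTheory GRing.Theory Num.Theory.

Local Open Scope nat_scope.

(* A partition is a sequence of positive integers considered up to [perm_eq]. *)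
Definition is_partition (p : seq nat) : bool := all (ltn 0) p.

Definition is_partition_of (d : nat) (p : seq nat) : bool :=
  is_partition p && (sumn p == d).

(* The truncated subtraction is harmless: for d < 3 (resp. d < 2) no partition
   of d satisfies these predicates. *)
Definition is_triple (d : nat) (p : seq nat) : bool :=
  perm_eq p (3 :: nseq (d - 3) 1).
Definition is_simple (d : nat) (p : seq nat) : bool :=
  perm_eq p (2 :: nseq (d - 2) 1).

Definition is_st_tuple (d s t : nat) (Lam : seq (seq nat)) : bool :=
  [&& size Lam == s + t, all (is_partition_of d) Lam,
      count (is_triple d) Lam == s & count (is_simple d) Lam == t].

Section Distribution.
Variable R : realType.

Definition branch : Type := ((R * R) + R)%type.

Definition is_pair (b : branch) : bool := if b is inl _ then true else false.

Definition branch_points (z : seq branch) : seq R :=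
  flatten [seq match b with inl p => [:: p.1; p.2] | inr y => [:: y] end | b <- z].

(* A distribution is given by the sequence z_1 < ... < z_(s+t) of its elements
   in the order of the real line. As the two points of a pair are consecutive in
   [branch_points z], strict sortedness says that the points are distinct,
   increasing, and that no single point lies in the interval of a pair. *)
Definition is_distribution (s t : nat) (z : seq branch) : bool :=
  [&& count is_pair z == s, count (predC is_pair) z == t
    & sorted <%R (branch_points z)].

Definition compatible (d : nat) (Lam : seq (seq nat)) (z : seq branch) : Prop :=
  [seq is_pair b | b <- z] = [seq is_triple d p | p <- Lam].

Definition trivial_distribution (s t : nat) (w : seq R) : seq branch :=
  mkseq (fun i => inl (nth 0%R w i.*2, nth 0%R w i.*2.+1)) s ++
  mkseq (fun j => inr (nth 0%R w (s.*2 + j))) t.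

End Distribution.

Section Graph.
Variables (nv ne : nat) (src tgt : 'I_ne -> 'I_nv).

Definition incident (e : 'I_ne) (x : 'I_nv) : bool := (src e == x) || (tgt e == x).

Definition joins (e : 'I_ne) (x y : 'I_nv) : bool :=
  ((src e == x) && (tgt e == y)) || ((src e == y) && (tgt e == x)).

Definition touching (e e' : 'I_ne) : bool := [exists x, incident e x && incident e' x].

Definition adj_in (A : {set 'I_ne}) : rel 'I_nv :=
  fun x y => [exists e in A, joins e x y].

(* Loops count twice. *)
Definition valence (x : 'I_nv) : nat := #|[set e | src e == x]| + #|[set e | tgt e == x]|.

Definition leaf (x : 'I_nv) : bool := valence x == 1.
Definition inner (x : 'I_nv) : bool := valence x == 3.
Definition is_end (e : 'I_ne) : bool := leaf (src e) || leaf (tgt e).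

End Graph.

(* Vertices and edges are labelled by initial segments of nat; curves and covers
   are only considered up to isomorphism, so the labels are immaterial. The
   orientation src -> tgt of the edges carries no structure of its own: for a
   cover it is the direction in which the map increases (see [is_cover]). *)
Record tropical_curve (R : realType) := TropicalCurve {
  nvert : nat;
  nedge : nat;
  src : 'I_nedge -> 'I_nvert;
  tgt : 'I_nedge -> 'I_nvert;
  len : 'I_nedge -> \bar R;
  _ : 0 < nvert;
  _ : forall x y, connect (adj_in src tgt [set: 'I_nedge]) x y;
  _ : forall x, leaf src tgt x || inner src tgt x;
  _ : forall e, is_end src tgt e -> len e = +oo%E;
  _ : forall e, ~~ is_end src tgt e -> exists2 l : R, (0 < l)%R & len e = l%:E }.

(* First Betti number of a connected graph. *)
Definition genus (R : realType) (C : tropical_curve R) : nat := (nedge C).+1 - nvert C.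

(* A map C -> [-oo, +oo] which is affine on each edge, given by its values at the
   vertices and its slopes. Which such maps are covers is said by [is_cover]. *)
Record weighted_map (R : realType) := WeightedMap {
  curve :> tropical_curve R;
  phi : 'I_(nvert curve) -> \bar R;
  wt : 'I_(nedge curve) -> nat }.

Notation vert f := 'I_(nvert (curve f)).
Notation edge f := 'I_(nedge (curve f)).

Section Cover.
Variables (R : realType) (f : weighted_map R).
Implicit Types (e a b c : edge f) (u v x : vert f) (P K : {set edge f}).

Definition inc e x : bool := incident (@src R f) (@tgt R f) e x.
Definition join e x y : bool := joins (@src R f) (@tgt R f) e x y.
Definition touch e e' : bool := touching (@src R f) (@tgt R f) e e'.
Definition adj (A : {set edge f}) : rel (vert f) := adj_in (@src R f) (@tgt R f) A.
Definition isleaf x : bool := leaf (@src R f) (@tgt R f) x.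
Definition isinner x : bool := inner (@src R f) (@tgt R f) x.
Definition isend e : bool := is_end (@src R f) (@tgt R f) e.
Definition edge_in x : {set edge f} := [set e | tgt e == x].
Definition edge_out x : {set edge f} := [set e | src e == x].
Definition even e : bool := ~~ odd (wt e).

(* The inner vertices in A are mapped onto the set of entries of l. *)
Definition inner_image (A : pred (vert f)) (l : seq R) : Prop :=
  forall r : \bar R,
    (exists x, [/\ A x, isinner x & phi x = r]) <-> r \in [seq y%:E | y <- l].

Definition is_cover (g : nat) (lambda mu : seq nat) (z : seq (branch R)) : Prop :=
  [/\ genus f = g,
      inner_image predT (branch_points z) /\ {in isinner &, injective (@phi R f)},
      forall x, isleaf x -> phi x = -oo%E \/ phi x = +oo%E,
      forall e, [/\ 0 < wt e, (phi (src e) < phi (tgt e))%E,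
        phi (src e) \is a fin_num ->
          phi (tgt e) = (phi (src e) + (wt e)%:R%:E * len e)%E &
        phi (tgt e) \is a fin_num ->
          phi (src e) = (phi (tgt e) - (wt e)%:R%:E * len e)%E] &
      [/\ forall x, isinner x ->
            \sum_(e in edge_in x) wt e = \sum_(e in edge_out x) wt e,
          perm_eq [seq wt e | e <- enum (edge f) & phi (src e) == -oo%E] lambda &
          perm_eq [seq wt e | e <- enum (edge f) & phi (tgt e) == +oo%E] mu]].

(* Symmetric cycles and forks are represented by their sets of two edges. *)
Definition Symc : {set {set edge f}} :=
  [set P | [exists a, exists b,
     [&& P == [set a; b], a != b, ~~ isend a, ~~ isend b, wt a == wt b &
         join b (src a) (tgt a)]]].

Definition Symf : {set {set edge f}} :=
  [set P | [exists a, exists b, exists x,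
     [&& P == [set a; b], a != b, isend a, isend b, wt a == wt b,
         isinner x, inc a x & inc b x]]].

Definition Sym : {set {set edge f}} := Symc :|: Symf.

Definition formA (v v' : vert f) : Prop :=
  exists a b c d h : edge f,
    [/\ a != b /\ edge_in v = [set a; b], edge_out v = [set c],
        tgt c = v', [/\ d != c, edge_in v' = [set c; d] & edge_out v' = [set h]] &
        [/\ wt a = wt b, wt c = 2 * wt a & [set a; b] \in Sym]].

Definition formA' (v v' : vert f) : Prop :=
  exists a b c d h : edge f,
    [/\ edge_in v = [set h], d != c /\ edge_out v = [set c; d],
        tgt c = v', [/\ a != b, edge_in v' = [set c] & edge_out v' = [set a; b]] &
        [/\ wt a = wt b, wt c = 2 * wt a & [set a; b] \in Sym]].

Definition formB_with (v v' : vert f) (i o c i' o' : edge f) : Prop :=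
  [/\ edge_in v = [set i], o != c /\ edge_out v = [set o; c],
      tgt c = v' /\ tgt o <> v',
      i' != c /\ edge_in v' = [set c; i'] & edge_out v' = [set o']].

Definition formB (v v' : vert f) : Prop :=
  exists i o c i' o', formB_with v v' i o c i' o'.

Definition formC (v v' : vert f) : Prop :=
  exists a b : edge f,
    [/\ a != b, src a = v /\ src b = v, tgt a = v' /\ tgt b = v' & even a || even b].

Definition resolving (z : seq (branch R)) : Prop :=
  forall p : R * R, inl p \in z ->
    exists v v', [/\ phi v = p.1%:E, phi v' = p.2%:E &
                  [\/ formA v v', formA' v v', formB v v' | formC v v']].

Section Resolving.
Variable z : seq (branch R).

Definition contr : {set edge f} :=
  [set e | has (fun q => if q is inl p then (phi (src e) == p.1%:E) && (phi (tgt e) == p.2%:E)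
                         else false) z].

Definition nc_Sym : {set {set edge f}} := [set P in Sym | [disjoint P & contr]].

Definition adj_contr P : bool := [exists e in P, exists c in contr, touch e c].

Definition Sym3 : {set {set edge f}} := [set P in nc_Sym | adj_contr P].
Definition Sym2 : {set {set edge f}} := [set P in nc_Sym | ~~ adj_contr P].

Definition Ec : {set edge f} := [set e in contr | even e].

Definition Symc_c : {set {set edge f}} := [set P in Symc | ~~ [disjoint P & contr]].

Definition Nsym_c : {set {set edge f}} :=
  [set P | [exists a, exists b,
     [&& P == [set a; b], a != b, a \in Ec, b \in Ec,
         join b (src a) (tgt a) & wt a != wt b]]].

End Resolving.

(* Tails. In each case K is the set of edges of the tail and v is the vertex at
   which its last edge is attached. *)

Definition end_tail (w : nat) K v : Prop :=
  exists c, [/\ K = [set c], isend c, wt c = 2 * w, isinner v & inc c v].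

Definition fork_tail (w : nat) K v : Prop :=
  exists a b c u,
    [/\ K = [set a; b; c], [set a; b] \in Symf /\ wt a = w,
        [/\ isinner u, inc a u & inc b u],
        ~~ isend c /\ join c u v & wt c = 2 * w].

(* An end of weight 2w, or a symmetric fork of weight w with an edge of weight 2w,
   followed by any number of symmetric cycles of weight w (joining u to u') each
   with its outgoing connecting edge of weight 2w. *)
Inductive chain_tail (w : nat) : {set edge f} -> vert f -> Prop :=
| chain_end K v : end_tail w K v -> chain_tail w K v
| chain_fork K v : fork_tail w K v -> chain_tail w K v
| chain_cycle K u a b c u' v :
    chain_tail w K u -> [set a; b] \in Symc -> wt a = w -> join a u u' ->
    ~~ isend c -> c \notin K -> join c u' v -> wt c = 2 * w ->
    chain_tail w (K :|: [set a; b; c]) v.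

Definition is_tail K v : Prop :=
  exists w, if odd w then chain_tail w K v else end_tail w K v \/ fork_tail w K v.

(* Connected component of C \ S containing the edge e, where S is the subgraph
   with vertices SV and edges SE: edges outside S are glued along the vertices
   outside S only. *)
Definition out_comp (SV : {set vert f}) (SE : {set edge f}) (e : edge f) : {set edge f} :=
  [set e' | connect (fun e1 e2 => [&& e1 \notin SE, e2 \notin SE &
                       [exists x, [&& x \notin SV, inc e1 x & inc e2 x]]]) e e'].

(* The subgraph S of a generalized zigzag cover. It is closed, so an end in S comes
   with its leaf. *)
Definition zigzag_subgraph (z : seq (branch R)) (SV : {set vert f}) (SE : {set edge f}) : Prop :=
  [/\ forall e, e \in SE -> (src e \in SV) && (tgt e \in SV),
      {in SV &, forall x y, connect (adj SE) x y},
      [disjoint SE & finset.cover (Sym2 z)],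
      contr z \subset SE /\ (exists2 x, x \in SV & isinner x) &
      (forall e, e \in SE -> even e -> e \in contr z) /\
      (forall e, e \notin SE -> exists v,
         [set x in SV | [exists e' in out_comp SV SE e, inc e' x]] = [set v] /\
         is_tail (out_comp SV SE e) v)].

Definition is_zigzag (g : nat) (lambda mu : seq nat) (z : seq (branch R)) : Prop :=
  [/\ is_cover g lambda mu z, resolving z &
      exists (SV : {set vert f}) (SE : {set edge f}), zigzag_subgraph z SV SE].

(* A candidate colouring: [true] is blue and [false] is red. The values of
   [blue] matter only at even edges not in [Irho]. *)
Record precoloring := PreColoring { Irho : {set {set edge f}}; blue : edge f -> bool }.

Section Coloring.
Variable rho : precoloring.

Definition coloured : {set edge f} := [set e | even e && (e \notin finset.cover (Irho rho))].

(* Being constant on the connected components of the coloured subgraph means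
   agreeing on edges which share an end point. *)
Definition is_coloring : Prop :=
  Irho rho \subset Sym /\
  {in coloured &, forall e e', touch e e' -> blue rho e = blue rho e'}.

Definition has_color (col : bool) e : bool := (e \in coloured) && (blue rho e == col).

(* With col := true: v is positive; with col := false: v is negative. The edge a
   is alone on its side of v, and b, c are on the other side. *)
Definition has_sign (col : bool) (v : vert f) : bool :=
  [exists a, exists b, exists c,
    [&& b != c,
        ((edge_in v == [set a]) && (edge_out v == [set b; c])) ||
        ((edge_out v == [set a]) && (edge_in v == [set b; c])) &
        [|| [&& odd (wt a), odd (wt b) & has_color col c],
            [&& has_color col a, has_color col b & has_color col c],
            [&& has_color (~~ col) a, odd (wt b), odd (wt c),
                b \notin finset.cover (Irho rho) & c \notin finset.cover (Irho rho)] |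
            has_color col a && ([set b; c] \in Irho rho)]]].

Definition effective (z : seq (branch R)) : Prop :=
  [/\ is_coloring,
      forall (p : R * R) v v', inl p \in z -> phi v = p.1%:E -> phi v' = p.2%:E ->
        exists col, has_sign col v && has_sign col v',
      Sym3 z \subset Irho rho &
      [disjoint Symc_c z & Irho rho]].

(* The set E(I_rho). *)
Definition E_I : {set edge f} := [set e in coloured | ~~ isend e].

(* Common weight of the edges in P. *)
Definition set_wt P : nat := \max_(e in P) wt e.

Definition multR (z : seq (branch R)) : rat :=
  (2%:R ^+ (#|E_I :\: Ec z| + #|Symc :&: Sym3 z| + #|Nsym_c z|) / 2%:R ^+ #|Sym2 z| *
   (\prod_(P in Symc :&: Irho rho) set_wt P)%:R)%R.

End Coloring.

Definition odd_mult (z : seq (branch R)) : Prop :=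
  exists rho : precoloring, effective rho z /\ exists k, multR rho z = (k.*2.+1)%:R%R.

(* w is the increasing list of all points of the trivial distribution; x and y are
   representatives of the two connected components of the complement of ec. *)
Definition is_properly_mixed (g : nat) (lambda mu : seq nat) (s t : nat) (w : seq R) : Prop :=
  let z := trivial_distribution s t w in
  [/\ is_cover g lambda mu z, resolving z &
  exists (SV : {set vert f}) (SE : {set edge f}), zigzag_subgraph z SV SE /\
  exists ec : edge f,
    [/\ [/\ ec \in SE, odd (wt ec) & ~~ isend ec],
        exists x y : vert f,
          [/\ ~~ connect (adj [set~ ec]) x y,
              forall u, connect (adj [set~ ec]) x u || connect (adj [set~ ec]) y u,
              inner_image (connect (adj [set~ ec]) x) (take s.*2 w) &
              inner_image (connect (adj [set~ ec]) y) (drop s.*2 w)],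
        exists v1' : vert f,
          [/\ phi v1' = (nth 0%R w 0)%:E, phi (src ec) = (nth 0%R w 1)%:E &
          exists i o c i' o' : edge f,
            [/\ formB_with v1' (src ec) i o c i' o',
                [/\ odd (wt i), odd (wt o), even c, odd (wt i') & odd (wt o')] &
                [/\ isend i, isend i' & wt i = wt i']]] &
        phi (tgt ec) = (nth 0%R w (s.*2 + t).-1)%:E /\
        exists a b : edge f,
          [/\ a != b, edge_in (tgt ec) = [set a; b], odd (wt a) & odd (wt b)]]].

End Cover.

Section Counting.
Variable R : realType.

(* A homeomorphism over the target maps inner vertices to inner vertices, ends to
   ends, and preserves slopes and the orientation of edges; it extends to the leaves
   and is determined by its effect on vertices and edges. *)
Definition cover_iso (f1 f2 : weighted_map R) : Prop :=
  exists (hV : vert f1 -> vert f2) (hE : edge f1 -> edge f2),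
    [/\ bijective hV, bijective hE,
        forall e, [/\ src (hE e) = hV (src e), tgt (hE e) = hV (tgt e) &
                      len (hE e) = len e],
        forall x, phi (hV x) = phi x & forall e, wt (hE e) = wt e].

Definition iso_class (f : weighted_map R) : set (weighted_map R) :=
  [set f' | cover_iso f f']%classic.

Definition iso_classes (A : set (weighted_map R)) : set (set (weighted_map R)) :=
  [set iso_class f | f in A]%classic.

(* The exponent m of an isomorphism class; being isomorphism invariant, the
   condition holds for one member of the class iff it holds for all of them. *)
Definition m_exp (z : seq (branch R)) (F : set (weighted_map R)) : nat :=
  if `[< exists2 f, F f & odd_mult f z >] then 0 else 1.

(* In both definitions the set of classes is finite, since the combinatorial type is
   bounded by the type of the cover and lengths are determined by map and weights. *)
Definition zigzag_number (g : nat) (lambda mu : seq nat) (z : seq (branch R)) : nat :=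
  \big[addn/0]_(F \in iso_classes [set f | is_zigzag f g lambda mu z]%classic) 2 ^ m_exp z F.

Definition proper_zigzag_number (g : nat) (lambda mu : seq nat) (s t : nat) (w : seq R) : nat :=
  \big[addn/0]_(F \in iso_classes
                  [set f | is_properly_mixed f g lambda mu s t w]%classic) 1.

End Counting.

(* Main.v *)
From mathcomp Require Import perm.
Require Import Defs.
From mathcomp Require Import all_boot all_order all_algebra finmap.
From mathcomp Require Import boolp classical_sets functions cardinality fsbigop.
From mathcomp Require Import reals constructive_ereal.
From mathcomp Require Import zify.

(** Every class of generalized zigzag covers contributes at least 1 to the
    generalized zigzag number, so it suffices to have finitely many such classes
    ([finite_cover_classes]) and an injection of the classes of properly mixed
    covers into them ([count_classes_le]).

    Cut a properly mixed cover at its edge E_c.  The pairs lie on one side and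
    the single points on the other, and every other edge stays on one side.  The
    points of [z] form the same two increasing lists, only shuffled differently.
    Moving the values of the inner vertices accordingly therefore keeps all
    edges increasing ([moved_lt]), except possibly E_c, which runs from the
    second point of the first pair to the last single point.  If these two
    points are still in this order, the graph, the weights and the contractible
    edges remain the same, and the moved cover is again a generalized zigzag
    cover ([moved_zigzag]).

    Otherwise, since no single point lies inside a pair, all single points come
    before all pairs.  Now the graph is changed around E_c.  Let v0, v1 be the
    vertices of the first pair, and v2 the end point of E_c:
<<
      before:   i --> v0 --o-->             after:   i --> v2 <-- j
                      |k                                   |k
                      v                                    v
                j --> v1 --E_c--> v2 --h-->                v0 --o-->
                                  ^                        |E_c
                                  |a                       v
                                                     a --> v1 --h-->
>>
    The ends i and j have the same odd weight m, and balancing gives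
    m = o + k and E_c = k + m for the weights.  Hence after giving the edge k the
    weight 2m = o + E_c, the new graph is balanced at v2 and v0, and at v1 with
    the same edges a, E_c and h that met at v2.  The new pair v0, v1 is of form
    (B) with the odd contractible edge E_c.  The fork of i and j followed by k is
    a new tail attached at v0, the end h is a tail attached at v1, and the other
    tails do not change ([twist_zigzag]).

    Both constructions are injective on classes.  The first one is undone by
    moving the values back.  For the second one, v0, v1 and v2 are recognized by
    their values, and then so are all edges around them, except that an
    isomorphism of the new covers may exchange the ends i and j; as these form a
    symmetric fork, this can be corrected by an automorphism
    ([twist_map_cover_iso]). *)

Set Implicit Arguments.
Unset Strict Implicit.
Unset Printing Implicit Defensive.

Import Order.TTheory GRing.Theory Num.Theory.

Local Open Scope nat_scope.

(** * Curves and covers *)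

Section Curve.
Variables (R : realType) (C : tropical_curve R).

Lemma curve_connected x y :
  connect (adj_in (@src R C) (@tgt R C) [set: 'I_(nedge C)]) x y.
Proof. by case: C x y. Qed.

Lemma curve_leaf_inner x :
  leaf (@src R C) (@tgt R C) x || inner (@src R C) (@tgt R C) x.
Proof. by case: C x. Qed.

Lemma curve_len_end e : is_end (@src R C) (@tgt R C) e -> len e = +oo%E.
Proof. by case: C e. Qed.

Lemma curve_len_inner e : ~~ is_end (@src R C) (@tgt R C) e ->
  exists2 l : R, (0 < l)%R & len e = l%:E.
Proof. by case: C e. Qed.

End Curve.

Section Weighted.
Variables (R : realType) (f : weighted_map R).
Implicit Types (x : vert f) (e : edge f).

Lemma isleafN x : isleaf x = ~~ isinner x.
Proof.
have := curve_leaf_inner x; rewrite /isleaf /isinner /leaf /inner.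
by case: (valence _ _ _) => [|[|[|[|n]]]].
Qed.

Lemma isendE e : isend e = ~~ (isinner (src e) && isinner (tgt e)).
Proof. by rewrite negb_and -!isleafN. Qed.

Lemma innerE x : isinner x = (#|edge_out x| + #|edge_in x| == 3).
Proof. by []. Qed.

Lemma leafE x : isleaf x = (#|edge_out x| + #|edge_in x| == 1).
Proof. by []. Qed.

Lemma leaf_uniq x e e' : isleaf x -> inc e x -> inc e' x -> e = e'.
Proof.
rewrite leafE /inc /incident => lf.
have -> (b : edge f) : (src b == x) || (tgt b == x) = (b \in edge_out x :|: edge_in x).
  by rewrite !inE.
move=> h1 h2; apply/eqP; case: eqP => // /eqP ne.
have /subset_leq_card : [set e; e'] \subset edge_out x :|: edge_in x.
  by apply/fintype.subsetP=> b; rewrite !(inE, in_set2) => /orP[] /eqP->;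
     move: h1 h2; rewrite !inE.
have [+ _] := leq_card_setU (edge_out x) (edge_in x).
by rewrite cards2 ne (eqP lf) => le lt; have := leq_trans lt le.
Qed.

Lemma leaf_edge x : isleaf x -> exists e, inc e x.
Proof.
rewrite leafE => /eqP lf.
have : 0 < #|edge_out x| \/ 0 < #|edge_in x| by lia.
by case=> /card_gt0P[e]; rewrite inE => h; exists e; rewrite /inc /incident h ?orbT.
Qed.

Lemma inc_src e : inc e (src e). Proof. by rewrite /inc /incident eqxx. Qed.
Lemma inc_tgt e : inc e (tgt e). Proof. by rewrite /inc /incident eqxx orbT. Qed.

Lemma adj_sym (A : {set edge f}) : connect_sym (adj A).
Proof.
apply: sym_connect_sym => x y; apply: eq_existsb => e.
by rewrite /joins orbC.
Qed.

Lemma Sym2E (z : seq (branch R)) (P : {set edge f}) :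
  (P \in Sym2 f z) = [&& P \in Sym f, [disjoint P & contr f z] & ~~ adj_contr z P].
Proof. by rewrite inE [P \in nc_Sym _ _]inE -andbA. Qed.

End Weighted.

Section IsCover.
Variables (R : realType) (f : weighted_map R).
Variables (g : nat) (lambda mu : seq nat) (z : seq (branch R)).
Hypothesis cov : is_cover f g lambda mu z.
Implicit Types (x : vert f) (e : edge f).

Lemma cover_inner_mem x : isinner x -> phi x \in [seq y%:E | y <- branch_points z].
Proof. by case: cov => _ [im _] _ _ _ ix; apply/im; exists x. Qed.

Lemma cover_fin x : (phi x \is a fin_num) = isinner x.
Proof.
apply/idP/idP; last first.
  by move=> /cover_inner_mem/mapP[y _ ->].
apply: contraLR; rewrite -isleafN.
by case: cov => _ _ lf _ _ /lf[] ->.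
Qed.

Lemma cover_lt e : (phi (src e) < phi (tgt e))%E.
Proof. by case: cov => _ _ _ /(_ e)[]. Qed.

Lemma cover_wt_gt0 e : 0 < wt e.
Proof. by case: cov => _ _ _ /(_ e)[]. Qed.

Lemma cover_src_leaf e : isleaf (src e) -> phi (src e) = -oo%E.
Proof.
case: cov => _ _ lf _ _ /lf[] // h.
by have := cover_lt e; rewrite h ltNge leey.
Qed.

Lemma cover_tgt_leaf e : isleaf (tgt e) -> phi (tgt e) = +oo%E.
Proof.
case: cov => _ _ lf _ _ /lf[] // h.
by have := cover_lt e; rewrite h ltNge leNye.
Qed.

Lemma cover_noloop e : src e != tgt e.
Proof. by apply/eqP => h; have := cover_lt e; rewrite h ltxx. Qed.

Lemma cover_len e : len e = if isend e then +oo%E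
  else ((fine (phi (tgt e)) - fine (phi (src e))) / (wt e)%:R)%:E.
Proof.
case: ifPn => [/curve_len_end //|ne].
have [l _ le] := curve_len_inner ne.
move: ne; rewrite isendE negbK -!cover_fin => /andP[/fineK hs /fineK ht].
have w0 : ((wt e)%:R != 0 :> R)%R by rewrite pnatr_eq0 -lt0n cover_wt_gt0.
case: cov => _ _ _ /(_ e)[_ _ + _] _.
rewrite -{1}hs /= -hs -ht le => /(_ isT) /=.
by case=> ->; rewrite addrAC subrr add0r mulrAC mulfV // mul1r.
Qed.

End IsCover.

(** * Isomorphisms of covers *)

(** Such a pair of bijections is an isomorphism as soon as both maps are covers,
    because the lengths are determined by the map and its slopes ([cover_len]). *)
Definition preserves_shape (R : realType) (f1 f2 : weighted_map R)
    (hV : vert f1 -> vert f2) (hE : edge f1 -> edge f2) : Prop :=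
  [/\ forall e, src (hE e) = hV (src e), forall e, tgt (hE e) = hV (tgt e),
      forall x, phi (hV x) = phi x & forall e, wt (hE e) = wt e].

Section Iso.
Variable R : realType.
Implicit Types f : weighted_map R.

Lemma cover_iso_refl f : cover_iso f f.
Proof. by exists id, id; split=> //; exists id. Qed.

Lemma cover_iso_sym f1 f2 : cover_iso f1 f2 -> cover_iso f2 f1.
Proof.
case=> hV [hE [[gV VK KV] [gE EK KE] hst hp hw]].
exists gV, gE; split; [by exists hV | by exists hE | | |].
- move=> e; have [h1 h2 h3] := hst (gE e); move: h1 h2 h3; rewrite KE => -> -> ->.
  by rewrite !VK.
- by move=> x; rewrite -hp KV.
- by move=> e; rewrite -hw KE.
Qed.

Lemma cover_iso_trans f1 f2 f3 : cover_iso f1 f2 -> cover_iso f2 f3 -> cover_iso f1 f3.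
Proof.
case=> hV [hE [bV bE hst hp hw]] [kV [kE [cV cE kst kp kw]]].
exists (kV \o hV), (kE \o hE); split; [exact: bij_comp | exact: bij_comp | | |].
- by move=> e /=; have [-> -> ->] := kst (hE e); have [-> -> ->] := hst e.
- by move=> x /=; rewrite kp hp.
- by move=> e /=; rewrite kw hw.
Qed.

Lemma iso_class_eq f1 f2 : iso_class f1 = iso_class f2 <-> cover_iso f1 f2.
Proof.
split=> [h|h].
  by have : iso_class f2 f2 by [exact: cover_iso_refl]; rewrite -h.
apply/seteqP; split=> f /=; rewrite /iso_class /=.
  by apply: cover_iso_trans; apply: cover_iso_sym.
exact: cover_iso_trans.
Qed.

Lemma cover_iso_of_shape f1 f2 g lambda mu z g' lambda' mu' z'
    (hV : vert f1 -> vert f2) (hE : edge f1 -> edge f2) :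
  is_cover f1 g lambda mu z -> is_cover f2 g' lambda' mu' z' ->
  bijective hV -> bijective hE -> preserves_shape hV hE -> cover_iso f1 f2.
Proof.
move=> c1 c2 bV bE [hs ht hp hw]; exists hV, hE; split=> // e; split=> //.
rewrite (cover_len c1) (cover_len c2) !isendE -!(cover_fin c1) -!(cover_fin c2).
by rewrite hs ht !hp hw.
Qed.

End Iso.

(** * Covers from combinatorial data *)

Section Affine.
Variable R : realType.

Lemma affine_endpoint (p q : \bar R) (n : nat) : p \is a fin_num -> q \is a fin_num ->
  0 < n -> q = (p + n%:R%:E * ((fine q - fine p) / n%:R)%:E)%E.
Proof.
case: p => [p||] //; case: q => [q||] // _ _ n0; rewrite -EFinM -EFinD.
apply: (congr1 EFin) => /=; rewrite mulrCA mulfV ?mulr1 1?addrC ?subrK //.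
by rewrite pnatr_eq0 -lt0n.
Qed.

Lemma affine_startpoint (p q : \bar R) (n : nat) : p \is a fin_num -> q \is a fin_num ->
  0 < n -> p = (q - n%:R%:E * ((fine q - fine p) / n%:R)%:E)%E.
Proof.
case: p => [p||] //; case: q => [q||] // _ _ n0; rewrite -EFinM -EFinB.
apply: (congr1 EFin) => /=; rewrite mulrCA mulfV ?mulr1 ?subKr //.
by rewrite pnatr_eq0 -lt0n.
Qed.

End Affine.

Section Build.
Variables (R : realType) (nv ne : nat) (sr tg : 'I_ne -> 'I_nv).
Variables (om : 'I_ne -> nat) (ph : 'I_nv -> \bar R).

(** Values at the vertices and positive weights determine the lengths of the
    inner edges, so only these conditions have to be checked to get a curve. *)
Record cover_data : Prop := CoverData {
  cd_pos : 0 < nv;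
  cd_conn : forall x y, connect (adj_in sr tg [set: 'I_ne]) x y;
  cd_val : forall x, leaf sr tg x || inner sr tg x;
  cd_leaf : forall x, leaf sr tg x -> ph x = -oo%E \/ ph x = +oo%E;
  cd_inner : forall x, inner sr tg x -> ph x \is a fin_num;
  cd_wt : forall e, 0 < om e;
  cd_lt : forall e, (ph (sr e) < ph (tg e))%E }.

Hypothesis cd : cover_data.

Definition slope_len e : \bar R := if is_end sr tg e then +oo%E
  else ((fine (ph (tg e)) - fine (ph (sr e))) / (om e)%:R)%:E.

Lemma data_not_end e : ~~ is_end sr tg e ->
  ph (sr e) \is a fin_num /\ ph (tg e) \is a fin_num.
Proof.
rewrite negb_or => /andP[h1 h2].
by split; apply: (cd_inner cd); [have := cd_val cd (sr e) | have := cd_val cd (tg e)];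
   rewrite ?(negPf h1) ?(negPf h2).
Qed.

Lemma slope_len_end e : is_end sr tg e -> slope_len e = +oo%E.
Proof. by rewrite /slope_len => ->. Qed.

Lemma slope_len_inner e : ~~ is_end sr tg e ->
  exists2 l : R, (0 < l)%R & slope_len e = l%:E.
Proof.
move=> h; rewrite /slope_len (negPf h); eexists; last by [].
have [h1 h2] := data_not_end h.
rewrite divr_gt0 ?ltr0n ?(cd_wt cd) // subr_gt0.
by have := cd_lt cd e; rewrite -(fineK h1) -(fineK h2) lte_fin.
Qed.

Definition built_curve : tropical_curve R :=
  @TropicalCurve R nv ne sr tg slope_len (cd_pos cd) (cd_conn cd) (cd_val cd)
    slope_len_end slope_len_inner.

Definition built : weighted_map R := @WeightedMap R built_curve ph om.

Lemma built_is_cover g lambda mu (z : seq (branch R)) :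
  ne.+1 - nv = g -> inner_image (f := built) predT (branch_points z) ->
  {in @isinner R built &, injective (@phi R built)} ->
  (forall x : vert built, isinner x ->
    \sum_(e in edge_in x) wt e = \sum_(e in edge_out x) wt e) ->
  perm_eq [seq om e | e <- enum 'I_ne & ph (sr e) == -oo%E] lambda ->
  perm_eq [seq om e | e <- enum 'I_ne & ph (tg e) == +oo%E] mu ->
  is_cover built g lambda mu z.
Proof.
move=> hg him hin hb hl hm; split=> //; first exact: (cd_leaf cd).
move=> e; split; [exact: (cd_wt cd) | exact: (cd_lt cd) | | ] => /= hf.
  have [he|/[dup] he /data_not_end[h1 h2]] := boolP (is_end sr tg e).
    rewrite slope_len_end // gt0_muley ?lte_fin ?ltr0n ?(cd_wt cd) //.
    have : inner sr tg (sr e).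
      have := cd_val cd (sr e); case: (boolP (inner _ _ _)) => //= _.
      by rewrite orbF => /(cd_leaf cd)[] hh; rewrite hh in hf.
    move: he; rewrite /is_end; case: (boolP (leaf _ _ (sr e))) => /=.
      by rewrite /leaf /inner => /eqP->.
    move=> _ /(cd_leaf cd)[] hh; last by rewrite hh -(fineK hf) .
    by have := cd_lt cd e; rewrite hh ltNge leNye.
  by rewrite /= /slope_len (negPf he); apply: affine_endpoint => //; apply: (cd_wt cd).
have [he|/[dup] he /data_not_end[h1 h2]] := boolP (is_end sr tg e).
  rewrite slope_len_end // gt0_muley ?lte_fin ?ltr0n ?(cd_wt cd) //.
  have : inner sr tg (tg e).
    have := cd_val cd (tg e); case: (boolP (inner _ _ _)) => //= _.
    by rewrite orbF => /(cd_leaf cd)[] hh; rewrite hh in hf.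
  move: he; rewrite /is_end; case: (boolP (leaf _ _ (tg e))) => /=.
    by rewrite /leaf /inner => /eqP->.
  rewrite orbF; move=> _ /(cd_leaf cd)[] hh; first by rewrite hh -(fineK hf).
  by have := cd_lt cd e; rewrite hh ltNge leey.
by rewrite /= /slope_len (negPf he); apply: affine_startpoint => //; apply: (cd_wt cd).
Qed.

End Build.

(** * Counting isomorphism classes *)

(** Finiteness of [B] is essential: a sum over an infinite set is 0. *)
Lemma fsum1_le_image (T : choiceType) (A B : set T) (h : T -> T) (m : T -> nat) :
  finite_set B -> (forall x, A x -> B (h x)) ->
  (forall x y, A x -> A y -> h x = h y -> x = y) ->
  \big[addn/0]_(x \in A) 1 <= \big[addn/0]_(x \in B) 2 ^ m x.
Proof.
move=> finB hAB inj.
have sub : (h @` A `<=` B)%classic by move=> _ [x Ax <-]; exact: hAB.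
have finhA := sub_finite_set sub finB.
have injA : set_inj A h.
  by move=> x y /set_mem Ax /set_mem Ay; apply: inj.
have -> : \big[addn/0]_(x \in A) 1 = \big[addn/0]_(y \in (h @` A)%classic) 1.
  by rewrite fsbig_image.
rewrite !fsbig_finite //= sum1_size.
apply: (@leq_trans (size (fset_set B))).
  apply: uniq_leq_size; first exact: fset_uniq.
  by move=> x; rewrite !in_fset_set // => /set_mem/sub/mem_set.
by rewrite -sum1_size; apply: leq_sum => i _; rewrite expn_gt0.
Qed.

(** The construction [rel] need not be a function, nor respect isomorphisms: one
    representative is chosen in each class, and one image of it. *)
Lemma count_classes_le (R : realType) (A B : set (weighted_map R))
    (rel : weighted_map R -> weighted_map R -> Prop) (m : set (weighted_map R) -> nat) :
  finite_set (iso_classes B) ->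
  (forall f, A f -> exists f', B f' /\ rel f f') ->
  (forall f1 f2 f1' f2', A f1 -> A f2 -> rel f1 f1' -> rel f2 f2' ->
     cover_iso f1' f2' -> cover_iso f1 f2) ->
  \big[addn/0]_(F \in iso_classes A) 1 <= \big[addn/0]_(F \in iso_classes B) 2 ^ m F.
Proof.
move=> finB ex inj.
have /choice[T HT] : forall f, exists f', A f -> B f' /\ rel f f'.
  move=> f; have [/ex[f' h]|nA] := pselect (A f); first by exists f'.
  by exists f.
have /choice[h Hh] : forall F : set (weighted_map R), exists F', iso_classes A F ->
    exists2 f, A f & F = iso_class f /\ F' = iso_class (T f).
  move=> F; have [[f Af <-]|nF] := pselect (iso_classes A F).
    by exists (iso_class (T f)) => _; exists f.
  by exists F.
apply: (@fsum1_le_image _ _ _ h) => //.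
  move=> F /Hh[f Af [_ ->]]; exists (T f) => //.
  by have [] := HT f Af.
move=> F1 F2 /Hh[f1 A1 [-> ->]] /Hh[f2 A2 [-> ->]] /iso_class_eq h12.
apply/iso_class_eq.
by have [_ r1] := HT _ A1; have [_ r2] := HT _ A2; apply: inj h12.
Qed.

(** * Finiteness of the set of covers of a given type *)

Section Bounds.
Variables (R : realType) (f : weighted_map R).
Variables (g : nat) (lambda mu : seq nat) (z : seq (branch R)).
Hypothesis cov : is_cover f g lambda mu z.
Implicit Types (x : vert f) (e : edge f).

Lemma card_source_ends : #|[set e : edge f | phi (src e) == -oo%E]| = size lambda.
Proof.
case: cov => _ _ _ _ [_ /perm_size <- _].
by rewrite size_map -sum1_size big_filter big_enum_cond -sum1dep_card.
Qed.

Lemma card_target_ends : #|[set e : edge f | phi (tgt e) == +oo%E]| = size mu.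
Proof.
case: cov => _ _ _ _ [_ _ /perm_size <-].
by rewrite size_map -sum1_size big_filter big_enum_cond -sum1dep_card.
Qed.

Lemma sum_source_ends : \sum_(e : edge f | phi (src e) == -oo%E) wt e = sumn lambda.
Proof.
case: cov => _ _ _ _ [_ /perm_sumn <- _].
by rewrite sumnE big_map big_filter big_enum_cond.
Qed.

Lemma leaf_incident_end x : isleaf x ->
  (exists2 e, phi (src e) = -oo%E & src e = x) \/
  (exists2 e, phi (tgt e) = +oo%E & tgt e = x).
Proof.
move=> lx; have [e /orP[]/eqP h] := leaf_edge lx.
  by left; exists e => //; apply: (cover_src_leaf cov); rewrite h.
by right; exists e => //; apply: (cover_tgt_leaf cov); rewrite h.
Qed.

(** Inner vertices are determined by their values, and leaves are end points of
    the ends, whose weights are the entries of [lambda] and [mu]. *)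
Lemma nvert_bound : nvert f <= size (branch_points z) + size lambda + size mu.
Proof.
rewrite -[nvert f]card_ord -card_source_ends -card_target_ends.
have inn : #|[set x : vert f | isinner x]| <= size (branch_points z).
  rewrite -(size_map EFin) cardE -(size_map (@phi R f)).
  apply: uniq_leq_size; last first.
    by move=> r /mapP[x]; rewrite mem_enum inE => ix ->; exact: (cover_inner_mem cov).
  rewrite map_inj_in_uniq ?enum_uniq // => x y; rewrite !mem_enum !inE.
  by case: cov => _ [_ inj] _ _ _; apply: inj.
pose S := [set x : vert f | isinner x] :|: [set src e | e : edge f in [set e : edge f | phi (src e) == -oo%E]]
   :|: [set tgt e | e : edge f in [set e : edge f | phi (tgt e) == +oo%E]].
have sub : [set: vert f] \subset S.
  apply/fintype.subsetP=> x _; rewrite !inE; case: (boolP (isinner x)) => //=.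
  rewrite -isleafN => /leaf_incident_end[][e h <-].
    by apply/orP; left; apply/imsetP; exists e; rewrite // inE h.
  by apply/orP; right; apply/imsetP; exists e; rewrite // inE h.
rewrite -cardsT; apply: leq_trans (subset_leq_card sub) _.
apply: leq_trans (leq_card_setU _ _) _; apply: leq_add; last exact: leq_imset_card.
apply: leq_trans (leq_card_setU _ _) _; apply: leq_add; last exact: leq_imset_card.
exact: inn.
Qed.

Lemma nedge_bound : nedge f <= 3 * nvert f.
Proof.
rewrite -[nedge f]card_ord -sum1_card (partition_big (@src R f) predT) //=.
rewrite mulnC -[X in _ <= X * 3]card_ord -sum_nat_const; apply: leq_sum => x _.
have -> : \sum_(e | src e == x) 1 = #|edge_out x|.
  by rewrite -sum1_card; apply: eq_bigl => e; rewrite inE.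
have := isleafN x; rewrite leafE innerE; set n := #|_|; set k := #|_|.
by case: eqP => [h _|_ /esym/negbFE/eqP h]; lia.
Qed.

(** By balancing, the weights of the edges crossing a level of the map add up to
    the total weight of the ends at minus infinity. *)
Lemma wt_bound e : wt e <= sumn lambda.
Proof.
(* The vertices up to the level at which [e] starts. *)
pose A := [set x : vert f | (phi x <= phi (src e))%E].
have tsA e' : tgt e' \in A -> src e' \in A.
  by rewrite !inE; apply: le_trans; apply/ltW/(cover_lt cov).
have out : \sum_(e' : edge f | src e' \in A) wt e' =
    \sum_(x in A) \sum_(e' in edge_out x) wt e'.
  rewrite (partition_big (@src R f) (mem A)) //=; apply: eq_bigr => x xA.
  by apply: eq_bigl => e'; rewrite [RHS]inE; case: eqP => [->|]; rewrite ?andbF //= xA.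
have inn : \sum_(e' : edge f | tgt e' \in A) wt e' =
    \sum_(x in A) \sum_(e' in edge_in x) wt e'.
  rewrite (partition_big (@tgt R f) (mem A)) //=; apply: eq_bigr => x xA.
  by apply: eq_bigl => e'; rewrite [RHS]inE; case: eqP => [->|]; rewrite ?andbF //= xA.
have src_le : \sum_(x in A) \sum_(e' in edge_out x) wt e' <=
    \sum_(x in A) \sum_(e' in edge_in x) wt e' +
    \sum_(x in A | phi x == -oo%E) \sum_(e' in edge_out x) wt e'.
  rewrite [X in _ <= _ + X]big_mkcondr -big_split /=; apply: leq_sum => x xA.
  case: (boolP (isinner x)) => [ix|].
    by case: cov => _ _ _ _ [/(_ _ ix) -> _ _]; exact: leq_addr.
  rewrite -isleafN => /leaf_incident_end[][e' h hx].
    by rewrite -hx h eqxx leq_addl.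
  move: xA; rewrite inE -hx h leye_eq => /eqP h'.
  by have := cover_lt cov e; rewrite h' ltNge leey.
have ends : \sum_(x in A | phi x == -oo%E) \sum_(e' in edge_out x) wt e' <= sumn lambda.
  rewrite -sum_source_ends [X in _ <= X](partition_big (@src R f) predT) //=.
  rewrite [X in _ <= X](bigID [pred x | (x \in A) && (phi x == -oo%E)]) /=.
  apply: leq_trans (leq_addr _ _); apply: leq_sum => x /andP[_ px].
  apply: eq_leq; apply: eq_bigl => e'; rewrite inE.
  by case: (src e' =P x) => [->|]; rewrite ?andbF ?px.
have cross : \sum_(e' : edge f | tgt e' \in A) wt e' + wt e <= \sum_(e' : edge f | src e' \in A) wt e'.
  rewrite [X in _ <= X](bigD1 e) /=; last by rewrite inE.
  rewrite addnC leq_add2l big_mkcond [X in _ <= X]big_mkcond /=.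
  apply: leq_sum => e' _; case: ifP => // /[dup] tA /tsA -> /=.
  by case: eqP => // ee; move: tA; rewrite ee inE leNgt (cover_lt cov).
by move: src_le ends cross; rewrite -out -inn; lia.
Qed.

End Bounds.

Section Finiteness.
Variables (R : realType) (g : nat) (lambda mu : seq nat) (z : seq (branch R)).

Let N := size (branch_points z) + size lambda + size mu.
Let values : seq (\bar R) := -oo%E :: +oo%E :: [seq y%:E | y <- branch_points z].

Let code_type : finType :=
  ('I_N.+1 * 'I_(3 * N).+1 *
   {ffun 'I_(3 * N).+1 -> 'I_N.+1 * 'I_N.+1 * 'I_(sumn lambda).+1} *
   {ffun 'I_N.+1 -> 'I_(size values).+1})%type.

(** Vertices and edges are already labelled by initial segments of the integers,
    so a bounded table suffices; entries beyond the size of the curve are filled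
    with default values. *)
Definition cover_code (f : weighted_map R) : code_type :=
  (inord (nvert f), inord (nedge f),
   [ffun k : 'I_(3 * N).+1 => if insub (val k) is Some e
      then (inord (val (@src R f e)), inord (val (@tgt R f e)), inord (@wt R f e))
      else (ord0, ord0, ord0)],
   [ffun k : 'I_N.+1 => if insub (val k) is Some x
      then inord (index (@phi R f x) values) else ord0]).

Lemma phi_values f x : is_cover f g lambda mu z -> @phi R f x \in values.
Proof.
move=> cov; case: (boolP (isinner x)) => [/(cover_inner_mem cov)|].
  by rewrite !inE => ->; rewrite !orbT.
rewrite -isleafN; case: cov => _ _ lf _ _ /lf[] ->; by rewrite !inE eqxx ?orbT.
Qed.

Lemma inord_inj n i j : i <= n -> j <= n -> inord i = inord j :> 'I_n.+1 -> i = j.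
Proof. by move=> hi hj /(congr1 val) /=; rewrite !inordK. Qed.

Lemma cover_code_iso f1 f2 : is_cover f1 g lambda mu z -> is_cover f2 g lambda mu z ->
  cover_code f1 = cover_code f2 -> cover_iso f1 f2.
Proof.
move=> c1 c2 [hn he hE hV].
have n1 : nvert f1 <= N := nvert_bound c1; have n2 : nvert f2 <= N := nvert_bound c2.
have e1 : nedge f1 <= 3 * N by apply: leq_trans (nedge_bound f1) _; rewrite leq_mul2l n1.
have e2 : nedge f2 <= 3 * N by apply: leq_trans (nedge_bound f2) _; rewrite leq_mul2l n2.
move/(inord_inj n1 n2): hn => hn; move/(inord_inj e1 e2): he => he.
apply: (cover_iso_of_shape c1 c2 (hV := cast_ord hn) (hE := cast_ord he)).
- by exists (cast_ord (esym hn)); [exact: cast_ordK | exact: cast_ordKV].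
- by exists (cast_ord (esym he)); [exact: cast_ordK | exact: cast_ordKV].
have edges e : [/\ val (src (cast_ord he e)) = val (src e),
    val (tgt (cast_ord he e)) = val (tgt e) & wt (cast_ord he e) = wt e].
  have k3 : e < (3 * N).+1 by apply: leq_trans (ltn_ord e) _; exact: leqW.
  move/ffunP/(_ (Ordinal k3)): hE; rewrite !ffunE.
  rewrite (valK e : insub (val (Ordinal k3)) = Some e).
  rewrite (valK (cast_ord he e) : insub (val (Ordinal k3)) = Some (cast_ord he e)).
  have small (h : weighted_map R) (x : vert h) : nvert h <= N -> val x <= N.
    by move=> hN; apply: leq_trans (ltnW (ltn_ord x)) hN.
  case=> h1 h2 h3; split; apply: esym.
  - exact: (inord_inj (small _ _ n1) (small _ _ n2) h1).
  - exact: (inord_inj (small _ _ n1) (small _ _ n2) h2).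
  - exact: (inord_inj (wt_bound c1 _) (wt_bound c2 _) h3).
split=> [e|e|x|e]; last 1 first.
- by have [] := edges e.
- by apply: val_inj; have [] := edges e.
- by apply: val_inj; have [] := edges e.
  have k3 : x < N.+1 by apply: leq_trans (ltn_ord x) _; exact: leqW.
  move/ffunP/(_ (Ordinal k3)): hV; rewrite !ffunE.
  rewrite (valK x : insub (val (Ordinal k3)) = Some x).
  rewrite (valK (cast_ord hn x) : insub (val (Ordinal k3)) = Some (cast_ord hn x)).
  move/inord_inj => ix.
  have v1 := phi_values x c1; have v2 := phi_values (cast_ord hn x) c2.
  by apply: (index_inj -oo%E v2 v1); apply: esym; apply: ix; exact: index_size.
Qed.

Lemma finite_cover_classes (P : set (weighted_map R)) :
  (forall f, P f -> is_cover f g lambda mu z) -> finite_set (iso_classes P).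
Proof.
move=> Pcov.
have /choice[h Hh] : forall c : code_type, exists F, forall f, P f -> cover_code f = c ->
    F = iso_class f.
  move=> c; have [[f Pf fc]|nf] := pselect (exists2 f, P f & cover_code f = c).
    exists (iso_class f) => f' Pf' f'c; apply/iso_class_eq.
    by apply: cover_code_iso; [exact: Pcov | exact: Pcov | rewrite fc f'c].
  by exists set0 => f Pf fc; case: nf; exists f.
apply: (@sub_finite_set _ _ (h @` [set: code_type])%classic).
  by move=> _ [f Pf <-]; exists (cover_code f) => //; apply: Hh.
by apply: finite_image; apply: finite_finset.
Qed.

End Finiteness.

(** * Regrouping the points of a distribution *)

Section Regroup.
Variable R : realType.
Implicit Types (z : seq (branch R)) (l : seq R).

Definition pair_points z : seq R :=
  flatten [seq if b is inl p then [:: p.1; p.2] else [::] | b <- z].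

Definition single_points z : seq R :=
  flatten [seq if b is inr y then [:: y] else [::] | b <- z].

Definition regrouped z : seq R := pair_points z ++ single_points z.

Lemma perm_regrouped z : perm_eq (regrouped z) (branch_points z).
Proof.
rewrite /regrouped; elim: z => [|[p|y] z IH] //=.
  by rewrite !perm_cons.
by rewrite -cat1s perm_catCA perm_cat2l.
Qed.

Lemma size_pair_points z : size (pair_points z) = (count (@is_pair R) z).*2.
Proof. by elim: z => [|[p|y] z IH] //=; rewrite IH; lia. Qed.

Lemma size_single_points z : size (single_points z) = count (predC (@is_pair R)) z.
Proof. by elim: z => [|[p|y] z IH] //=; rewrite IH. Qed.

Lemma subseq_pair_points z : subseq (pair_points z) (branch_points z).
Proof.
elim: z => [|[p|y] z IH] //=; first by rewrite !eqxx.
exact: subseq_trans IH (subseq_cons _ _).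
Qed.

Lemma subseq_single_points z : subseq (single_points z) (branch_points z).
Proof.
elim: z => [|[p|y] z IH] //=; last by rewrite eqxx.
apply: subseq_trans IH (subseq_trans (subseq_cons _ p.2) (subseq_cons _ _)).
Qed.

(** Pairs are referred to by their positions in a list, so that the pairs of two
    distributions listed in this way correspond to each other. *)
Definition pairs_listed z s l : Prop :=
  forall p : R * R, inl p \in z <-> exists2 j, j < s & p = (nth 0%R l j.*2, nth 0%R l j.*2.+1).

Lemma pairs_listed_trivial s t w : pairs_listed (trivial_distribution s t w) s w.
Proof.
move=> p; rewrite mem_cat; split.
  case/orP=> /mapP[j]; rewrite mem_iota //= => js [->].
  by exists j.
case=> j js ->; apply/orP; left; apply/mapP; exists j => //.
by rewrite mem_iota.
Qed.

Lemma pairs_listed_regrouped z : pairs_listed z (count (@is_pair R) z) (regrouped z).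
Proof.
move=> p; have -> : (exists2 j, j < count (@is_pair R) z &
     p = (nth 0%R (regrouped z) j.*2, nth 0%R (regrouped z) j.*2.+1)) <->
   (exists2 j, j < count (@is_pair R) z &
     p = (nth 0%R (pair_points z) j.*2, nth 0%R (pair_points z) j.*2.+1)).
  split=> -[j js ->]; exists j => //; rewrite /regrouped !nth_cat size_pair_points.
    by rewrite ltn_double js ltn_Sdouble js.
  by rewrite ltn_double js ltn_Sdouble js.
elim: z => [|[q|y] z IH] /=.
- by split=> // -[].
- rewrite in_cons; split=> [/orP[/eqP[->]|h]|[[|j] js pE]].
  + by exists 0 => //; case: q.
  + by have [j js ->] := IH.1 h; exists j.+1.
  + by rewrite pE /= -surjective_pairing eqxx.
  + by apply/orP; right; apply: IH.2; exists j.
- rewrite in_cons /= add0n; exact: IH.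
Qed.

Lemma single_outside_pair z (p : R * R) y : sorted <%R (branch_points z) ->
  inl p \in z -> y \in single_points z -> (y < p.1)%R || (p.2 < y)%R.
Proof.
move=> + /path.splitPr pz; case: z / pz => z1 z2.
have -> : branch_points (z1 ++ inl p :: z2) =
    branch_points z1 ++ [:: p.1; p.2] ++ branch_points z2.
  by rewrite /branch_points map_cat flatten_cat.
have -> : single_points (z1 ++ inl p :: z2) = single_points z1 ++ single_points z2.
  by rewrite /single_points map_cat flatten_cat.
rewrite (sorted_pairwise lt_trans) pairwise_cat allrel_catr.
move=> /and3P[/andP[/allrelP h1 _] _]; rewrite pairwise_cat => /and3P[/allrelP h2 _ _].
rewrite mem_cat => /orP[]/(mem_subseq (subseq_single_points _)) hy.
  by rewrite h1 // mem_head.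
by rewrite (h2 p.2) ?orbT // mem_seq2 eqxx orbT.
Qed.

End Regroup.

(** * Moving the values of the inner vertices *)

Definition relabel (R : realType) (l l' : seq R) (r : \bar R) : \bar R :=
  if r is EFin x then (nth 0%R l' (index x l))%:E else r.

Section Relabel.
Variables (R : realType) (l l' : seq R).
Hypotheses (l_uniq : uniq l) (l'_uniq : uniq l') (size_l : size l = size l').

Lemma relabel_nth n : n < size l -> relabel l l' (nth 0%R l n)%:E = (nth 0%R l' n)%:E.
Proof. by move=> nl; rewrite /= index_uniq. Qed.

Lemma relabel_fin r : (relabel l l' r \is a fin_num) = (r \is a fin_num).
Proof. by case: r. Qed.

Lemma relabel_ninfty r : (relabel l l' r == -oo%E) = (r == -oo%E).
Proof. by case: r. Qed.

Lemma relabel_pinfty r : (relabel l l' r == +oo%E) = (r == +oo%E).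
Proof. by case: r. Qed.

Lemma relabel_inj (r r' : \bar R) :
  (r \is a fin_num -> exists2 n, n < size l & r = (nth 0%R l n)%:E) ->
  (r' \is a fin_num -> exists2 n, n < size l & r' = (nth 0%R l n)%:E) ->
  relabel l l' r = relabel l l' r' -> r = r'.
Proof.
case: r => [r||]; case: r' => [r'||] //= /(_ isT)[n nl [->]] /(_ isT)[n' nl' [->]] [].
rewrite !index_uniq // => /eqP; rewrite nth_uniq -?size_l //.
by move=> /eqP->.
Qed.

Lemma relabel_eq_nth r n : n < size l ->
  (r \is a fin_num -> exists2 n, n < size l & r = (nth 0%R l n)%:E) ->
  relabel l l' r = (nth 0%R l' n)%:E <-> r = (nth 0%R l n)%:E.
Proof.
move=> nl hr; rewrite -relabel_nth //; split=> [|->] //.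
by apply: relabel_inj => // _; exists n.
Qed.

End Relabel.

(** What matters of a properly mixed cover for moving its values: the cut edge
    [ec] is the only one joining [X], which carries the pairs, to the rest,
    which carries the single points.  Values are given by positions in [w]. *)
Record split_cover (R : realType) (f : weighted_map R) (s t : nat) (w : seq R)
    (ec : edge f) (X : pred (vert f)) : Prop := SplitCover {
  split_src : X (src ec);
  split_tgt : ~~ X (tgt ec);
  split_side : forall e, e != ec -> X (src e) = X (tgt e);
  split_low : forall x, isinner x -> X x ->
    exists2 n, n < s.*2 & phi x = (nth 0%R w n)%:E;
  split_high : forall x, isinner x -> ~~ X x ->
    exists2 n, s.*2 <= n < s.*2 + t & phi x = (nth 0%R w n)%:E;
  split_surj : forall n, n < s.*2 + t ->
    exists2 x : vert f, isinner x & phi x = (nth 0%R w n)%:E;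
  split_s : 0 < s;
  split_t : 0 < t;
  split_phi_src : phi (src ec) = (nth 0%R w 1)%:E;
  split_phi_tgt : phi (tgt ec) = (nth 0%R w (s.*2 + t).-1)%:E }.

(** The lists [l] whose entries can replace those of [w], position by position:
    the first [s.*2] are the points of the pairs and the others the single
    points, both in increasing order, and no single point is inside a pair. *)
Record regrouping (R : realType) (s t : nat) (z : seq (branch R)) (l : seq R) : Prop :=
  Regrouping {
  rg_size : size l = s.*2 + t;
  rg_uniq : uniq l;
  rg_perm : perm_eq l (branch_points z);
  rg_pairs : pairs_listed z s l;
  rg_low : forall m n, m < n < s.*2 -> (nth 0%R l m < nth 0%R l n)%R;
  rg_high : forall m n, s.*2 <= m -> m < n < s.*2 + t -> (nth 0%R l m < nth 0%R l n)%R;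
  rg_outside : forall j n, j < s -> s.*2 <= n < s.*2 + t ->
    (nth 0%R l n < nth 0%R l j.*2)%R || (nth 0%R l j.*2.+1 < nth 0%R l n)%R }.

Lemma regrouping_regrouped (R : realType) s t (z : seq (branch R)) :
  is_distribution s t z -> regrouping s t z (regrouped z).
Proof.
case/and3P=> /eqP cs /eqP ct srt.
have sz : size (regrouped z) = s.*2 + t.
  by rewrite size_cat size_pair_points size_single_points cs ct.
have pl := pairs_listed_regrouped z; rewrite cs in pl.
split=> //.
- by rewrite (perm_uniq (perm_regrouped z)); apply: lt_sorted_uniq.
- exact: perm_regrouped.
- move=> m n /andP[mn ns]; rewrite !nth_cat size_pair_points cs ns (ltn_trans mn ns).
  have := subseq_sorted lt_trans (subseq_pair_points z) srt.
  by move/(sorted_ltn_nth lt_trans 0%R); apply; rewrite ?inE ?size_pair_points ?cs //;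
     apply: ltn_trans ns.
- move=> m n sm /andP[mn ns]; rewrite !nth_cat size_pair_points cs.
  rewrite !ltnNge sm (leq_trans sm (ltnW mn)) /=.
  have := subseq_sorted lt_trans (subseq_single_points z) srt.
  by move/(sorted_ltn_nth lt_trans 0%R); apply; rewrite ?inE ?size_single_points ?ct //; lia.
- move=> j n js /andP[sn ns].
  have /pl hp : exists2 j', j' < s & (nth 0%R (regrouped z) j.*2, nth 0%R (regrouped z) j.*2.+1) =
     (nth 0%R (regrouped z) j'.*2, nth 0%R (regrouped z) j'.*2.+1) by exists j.
  apply: (single_outside_pair srt hp).
  rewrite /regrouped nth_cat size_pair_points cs ltnNge sn /=; apply: mem_nth.
  by rewrite size_single_points ct; lia.
Qed.

Section Contractible.
Variables (R : realType) (f : weighted_map R) (s : nat) (z : seq (branch R)) (l : seq R).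
Hypothesis zl : pairs_listed z s l.

Lemma contrP (e : edge f) : reflect
  (exists2 j, j < s & phi (src e) = (nth 0%R l j.*2)%:E /\ phi (tgt e) = (nth 0%R l j.*2.+1)%:E)
  (e \in contr f z).
Proof.
rewrite inE; apply: (iffP hasP) => [[[p|//] /zl[j js ->] /= /andP[/eqP h1 /eqP h2]]|].
  by exists j.
case=> j js [h1 h2]; exists (inl (nth 0%R l j.*2, nth 0%R l j.*2.+1)).
  by apply/zl; exists j.
by rewrite /= h1 h2 !eqxx.
Qed.

End Contractible.

(** * Cutting a cover at an edge *)

Section CutAtEdge.
Variables (R : realType) (f : weighted_map R) (ec : edge f) (x y : vert f).
Hypothesis sep : ~~ connect (adj [set~ ec]) x y.
Hypothesis cov2 : forall u, connect (adj [set~ ec]) x u || connect (adj [set~ ec]) y u.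
Let X := connect (adj [set~ ec]) x.

Lemma cut_side e : e != ec -> X (src e) = X (tgt e).
Proof.
move=> ne; have h : connect (adj [set~ ec]) (src e) (tgt e).
  by apply/connect1/existsP; exists e; rewrite !inE ne /joins !eqxx.
have h' : connect (adj [set~ ec]) (tgt e) (src e) by rewrite adj_sym.
by apply/idP/idP => hX; apply: connect_trans hX _.
Qed.

Lemma cut_other u : ~~ X u = connect (adj [set~ ec]) y u.
Proof.
case: (boolP (X u)) (cov2 u) => /= [xu|nxu]; last by move: nxu; rewrite /X => /negPf-> /= ->.
move=> _; apply/esym/negbTE; apply: contra sep => yu.
by apply: connect_trans xu _; rewrite adj_sym.
Qed.

(** If both end points of [ec] were on the same side, no edge at all would join
    the two sides, and the curve would not be connected. *)
Lemma cut_separates : X (src ec) = ~~ X (tgt ec).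
Proof.
apply/idP/idP => [xs|xt]; apply/negP => h; apply/negP: sep; rewrite negbK.
  have all_X u : connect (adj [set: edge f]) x u -> X u.
    case/connectP=> p; elim/last_ind: p u => [|p v IH] u /=; first by move=> _ ->; apply: connect0.
    rewrite rcons_path last_rcons => /andP[/IH/(_ erefl) hl /existsP[e /andP[_ je]]] ->.
    have [ee|ne] := eqVneq e ec.
      by move: je; rewrite ee => /orP[/andP[_ /eqP<-]|/andP[/eqP<- _]].
    by move: je hl (cut_side ne) => /orP[]/andP[/eqP <- /eqP <-] + hs; rewrite hs.
  exact/all_X/curve_connected.
have all_Y u : connect (adj [set: edge f]) y u -> ~~ X u.
  case/connectP=> p; elim/last_ind: p u => [|p v IH] u /=.
    by move=> _ ->; rewrite cut_other connect0.
  rewrite rcons_path last_rcons => /andP[/IH/(_ erefl) hl /existsP[e /andP[_ je]]] ->.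
  have [ee|ne] := eqVneq e ec.
    by move: je; rewrite ee => /orP[/andP[_ /eqP<-]|/andP[/eqP<- _]] //; apply/negP.
  by move: je hl (cut_side ne) => /orP[]/andP[/eqP <- /eqP <-] + hs; rewrite hs.
by have := all_Y x (curve_connected y x); rewrite /X connect0.
Qed.

End CutAtEdge.

Section Split.
Variables (R : realType) (g : nat) (lambda mu : seq nat) (s t : nat).
Variables (w : seq R) (f : weighted_map R).
Hypotheses (w_size : size w = s.*2 + t) (w_uniq : uniq w).

Lemma inner_image_take (A : pred (vert f)) x : inner_image A (take s.*2 w) ->
  isinner x -> A x -> exists2 n, n < s.*2 & phi x = (nth 0%R w n)%:E.
Proof.
move=> im ix Ax; have /mapP[r /(nthP 0%R)[n nl <-] ->] : phi x \in [seq y%:E | y <- take s.*2 w].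
  by apply/im; exists x.
exists n; last by rewrite nth_take //; move: nl; rewrite size_take_min; lia.
by move: nl; rewrite size_take_min; lia.
Qed.

Lemma inner_image_drop (A : pred (vert f)) x : inner_image A (drop s.*2 w) ->
  isinner x -> A x -> exists2 n, s.*2 <= n < s.*2 + t & phi x = (nth 0%R w n)%:E.
Proof.
move=> im ix Ax; have /mapP[r /(nthP 0%R)[n nl <-] ->] : phi x \in [seq y%:E | y <- drop s.*2 w].
  by apply/im; exists x.
exists (s.*2 + n); last by rewrite nth_drop.
by move: nl; rewrite size_drop w_size; lia.
Qed.

(** The start of [ec] has the second smallest value. On the side of the single
    points this would mean that there are no pairs, although [tgt ec] would then
    be an inner vertex on the side of the pairs. *)
Lemma properly_mixed_split (ec : edge f) (x y : vert f) :
  ~~ isend ec ->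
  ~~ connect (adj [set~ ec]) x y ->
  (forall u, connect (adj [set~ ec]) x u || connect (adj [set~ ec]) y u) ->
  inner_image (connect (adj [set~ ec]) x) (take s.*2 w) ->
  inner_image (connect (adj [set~ ec]) y) (drop s.*2 w) ->
  phi (src ec) = (nth 0%R w 1)%:E ->
  phi (tgt ec) = (nth 0%R w (s.*2 + t).-1)%:E ->
  split_cover s t w ec (connect (adj [set~ ec]) x).
Proof.
rewrite isendE negbK => /andP[is_ it] sep cov2 imx imy ps pt.
set X := connect _ x.
have Xy u : ~~ X u -> connect (adj [set~ ec]) y u by rewrite (cut_other sep cov2).
have Xsep := cut_separates sep cov2; rewrite -/X in Xsep.
have nth_eq m n : m < s.*2 + t -> n < s.*2 + t ->
    (nth 0%R w m)%:E = (nth 0%R w n)%:E :> \bar R -> m = n.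
  by move=> hm hn [] /eqP; rewrite nth_uniq ?w_size // => /eqP.
have Xs : X (src ec).
  apply/negPn/negP => /[dup] nXs /Xy ys.
  have Xt : X (tgt ec) by move: nXs; rewrite Xsep negbK.
  have [n ns _] := inner_image_take imx it Xt.
  have [m /andP[sm mt]] := inner_image_drop imy is_ ys.
  by rewrite ps => /nth_eq; lia.
have Xt : ~~ X (tgt ec) by rewrite -Xsep.
have [n ns _] := inner_image_take imx is_ Xs.
have [m mst _] := inner_image_drop imy it (Xy _ Xt).
split=> //.
- by move=> e; exact: cut_side.
- by move=> u iu Xu; exact: inner_image_take imx iu Xu.
- by move=> u iu /Xy yu; exact: inner_image_drop imy iu yu.
- move=> k kn; have [ks|ks] := ltnP k s.*2.
    have : (nth 0%R w k)%:E \in [seq y%:E | y <- take s.*2 w].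
      by apply/map_f; rewrite -(nth_take _ ks) mem_nth // size_take_min w_size; lia.
    by case/imx => u [_ iu pu]; exists u.
  have : (nth 0%R w k)%:E \in [seq y%:E | y <- drop s.*2 w].
    apply/map_f; rewrite (_ : k = s.*2 + (k - s.*2)); last by lia.
    by rewrite -nth_drop mem_nth // size_drop w_size; lia.
  by case/imy => u [_ iu pu]; exists u.
- by lia.
- by lia.
Qed.

End Split.

(** * Moving the values of a split cover *)

Section Move.
Variables (R : realType) (g : nat) (lambda mu : seq nat) (s t : nat).
Variables (w l : seq R) (z0 z : seq (branch R)) (f : weighted_map R).
Variables (ec : edge f) (X : pred (vert f)).
Hypotheses (w_size : size w = s.*2 + t) (w_uniq : uniq w).
Hypothesis w_mono : forall m n, m < n < s.*2 + t -> (nth 0%R w m < nth 0%R w n)%R.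
Hypothesis cov : is_cover f g lambda mu z0.
Hypothesis sp : split_cover s t w ec X.
Hypothesis rg : regrouping s t z l.

Notation sigma := (relabel w l).

Lemma moved_size : size w = size l. Proof. by rewrite w_size (rg_size rg). Qed.

Lemma split_values (x : vert f) : phi x \is a fin_num ->
  exists2 n, n < size w & phi x = (nth 0%R w n)%:E.
Proof.
rewrite (cover_fin cov) w_size => ix; case: (boolP (X x)) => Xx.
  by have [n ns ->] := split_low sp ix Xx; exists n => //; lia.
by have [n /andP[_ ns] ->] := split_high sp ix Xx; exists n.
Qed.

Lemma moved_inj (x y : vert f) : sigma (phi x) = sigma (phi y) -> phi x = phi y.
Proof. by apply: (relabel_inj w_uniq (rg_uniq rg) moved_size); exact: split_values. Qed.

Lemma moved_nth (x : vert f) n : n < s.*2 + t ->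
  sigma (phi x) = (nth 0%R l n)%:E <-> phi x = (nth 0%R w n)%:E.
Proof.
rewrite -w_size => nw; apply: (relabel_eq_nth w_uniq (rg_uniq rg) moved_size nw).
exact: split_values.
Qed.

(** Edges other than [ec] join vertices on the same side, where the order of the
    values does not change. *)
Lemma moved_lt (e : edge f) : e != ec -> (sigma (phi (src e)) < sigma (phi (tgt e)))%E.
Proof.
move=> ne; have lt_e := cover_lt cov e.
case: (boolP (phi (src e) \is a fin_num)) => [fs|nfs]; last first.
  have -> : phi (src e) = -oo%E.
    by apply: (cover_src_leaf cov); rewrite isleafN -(cover_fin cov).
  rewrite /= ltNye -(relabel_ninfty w l); move: lt_e.
  by case: (phi (tgt e)) => //=; rewrite ltNge leNye.
case: (boolP (phi (tgt e) \is a fin_num)) => [ft|nft]; last first.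
  have -> : phi (tgt e) = +oo%E.
    by apply: (cover_tgt_leaf cov); rewrite isleafN -(cover_fin cov).
  by move: fs; rewrite -(relabel_fin w l); case: (sigma _) => //= r _; exact: ltry.
rewrite !(cover_fin cov) in fs ft.
have nlt m n : m < s.*2 + t -> n < s.*2 + t ->
    ((nth 0%R w m)%:E < (nth 0%R w n)%:E)%E -> m < n.
  rewrite lte_fin => hm hn h; rewrite ltnNge; apply/negP; rewrite leq_eqVlt => /orP[/eqP nm|nm].
    by move: h; rewrite nm ltxx.
  by have := @w_mono n m; rewrite nm hm => /(_ isT); rewrite ltNge (ltW h).
case: (boolP (X (src e))) => Xs.
  have Xt : X (tgt e) by rewrite -(split_side sp ne).
  move: lt_e; have [m ms ->] := split_low sp fs Xs; have [n ns ->] := split_low sp ft Xt.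
  rewrite !relabel_nth ?w_size //; try by lia.
  move=> /nlt mn; rewrite lte_fin; apply: (rg_low rg).
  by rewrite ns mn //; lia.
have Xt : ~~ X (tgt e) by rewrite -(split_side sp ne).
move: lt_e; have [m /andP[m1 ms] ->] := split_high sp fs Xs.
have [n /andP[n1 ns] ->] := split_high sp ft Xt.
rewrite !relabel_nth ?w_size //; move=> /nlt mn; rewrite lte_fin; apply: (rg_high rg) => //.
by rewrite ns mn.
Qed.

Lemma moved_image (r : \bar R) :
  (exists2 x : vert f, isinner x & sigma (phi x) = r) <-> r \in [seq y%:E | y <- branch_points z].
Proof.
have bp y : (y \in branch_points z) = (y \in l) by rewrite (perm_mem (rg_perm rg)).
split=> [[x ix <-]|/mapP[y]].
  have [n nw] : exists2 n, n < size w & phi x = (nth 0%R w n)%:E.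
    by apply: split_values; rewrite (cover_fin cov).
  move=> ->; rewrite relabel_nth //; apply: map_f; rewrite bp mem_nth // -moved_size //.
rewrite bp => /(nthP 0%R)[n nl <-] ->.
have nn : n < s.*2 + t by rewrite -w_size moved_size.
have [x ix px] := split_surj sp nn.
by exists x => //; rewrite px relabel_nth // moved_size.
Qed.

End Move.

(** * Changing a cover away from a set of edges *)

Section Unchanged.
Variables (R : realType) (f : weighted_map R).
Variables (sr tg : edge f -> vert f) (om : edge f -> nat) (ph : vert f -> \bar R).
Hypothesis cd : cover_data sr tg om ph.
Variable U : {set edge f}.
Hypothesis sr_U : {in U, sr =1 @src R f}.
Hypothesis tg_U : {in U, tg =1 @tgt R f}.
Hypothesis om_U : {in U, om =1 @wt R f}.
Hypothesis inner_eq : forall x, inner sr tg x = @isinner R f x.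
Notation f' := (built cd).

Lemma isinner_unchanged x : @isinner R f' x = @isinner R f x.
Proof. exact: inner_eq. Qed.

Lemma inc_unchanged e x : e \in U -> @inc R f' e x = @inc R f e x.
Proof. by move=> eU; rewrite /inc /incident /= sr_U ?tg_U. Qed.

Lemma join_unchanged e x y : e \in U -> @join R f' e x y = @join R f e x y.
Proof. by move=> eU; rewrite /join /joins /= sr_U ?tg_U. Qed.

Lemma isend_unchanged e : e \in U -> @isend R f' e = @isend R f e.
Proof. by move=> eU; rewrite !isendE /= sr_U ?tg_U // !isinner_unchanged. Qed.

Lemma Symc_unchanged (P : {set edge f}) : P \subset U ->
  (P \in Symc f') = (P \in Symc f).
Proof.
move=> PU; rewrite !inE; apply: eq_existsb => a; apply: eq_existsb => b.
case: eqP => //= Pab; have /andP[aU bU] : (a \in U) && (b \in U).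
  by rewrite !(fintype.subsetP PU) // Pab !inE eqxx ?orbT.
by rewrite !isend_unchanged // join_unchanged //= sr_U // tg_U // !om_U.
Qed.

Lemma Symf_unchanged (P : {set edge f}) : P \subset U ->
  (P \in Symf f') = (P \in Symf f).
Proof.
move=> PU; rewrite !inE; apply: eq_existsb => a; apply: eq_existsb => b.
apply: eq_existsb => x.
case: eqP => //= Pab; have /andP[aU bU] : (a \in U) && (b \in U).
  by rewrite !(fintype.subsetP PU) // Pab !inE eqxx ?orbT.
by rewrite !isend_unchanged // !inc_unchanged //= !om_U // isinner_unchanged.
Qed.

Lemma Sym_unchanged (P : {set edge f}) : P \subset U -> (P \in Sym f') = (P \in Sym f).
Proof. by move=> PU; rewrite !finset.in_setU Symc_unchanged ?Symf_unchanged. Qed.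

Lemma set2_sub (a b : edge f) : a \in U -> b \in U -> [set a; b] \subset U.
Proof. by move=> aU bU; apply/fintype.subsetP => e /set2P[] ->. Qed.

Lemma end_tail_unchanged k (K : {set edge f}) v : K \subset U ->
  @end_tail R f k K v -> @end_tail R f' k K v.
Proof.
move=> + [c [Kc ec wc iv cv]]; rewrite Kc finset.sub1set => cU; exists c; split=> //=.
- by rewrite isend_unchanged.
- by rewrite om_U.
- by rewrite isinner_unchanged.
- by rewrite inc_unchanged.
Qed.

Lemma fork_tail_unchanged k (K : {set edge f}) v : K \subset U ->
  @fork_tail R f k K v -> @fork_tail R f' k K v.
Proof.
move=> + [a [b [c [u [Kc [sab wa] [iu au bu] [ec cuv] wc]]]]].
rewrite Kc !finset.subUset !finset.sub1set => /andP[/andP[aU bU] cU].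
exists a, b, c, u; split=> //.
- by rewrite Symf_unchanged ?set2_sub //= om_U.
- by rewrite isinner_unchanged !inc_unchanged.
- by rewrite isend_unchanged // join_unchanged.
- by rewrite /= om_U.
Qed.

Lemma chain_tail_unchanged k (K : {set edge f}) v : K \subset U ->
  @chain_tail R f k K v -> @chain_tail R f' k K v.
Proof.
move=> + tail; elim: tail => {K v} [K v tl KU|K v tl KU|].
- by apply: chain_end; apply: end_tail_unchanged.
- by apply: chain_fork; apply: fork_tail_unchanged.
move=> K u a b c u' v _ IH sab wa au ec cK cv wc.
rewrite !finset.subUset !finset.sub1set => /and3P[KU /andP[aU bU] cU].
apply: (@chain_cycle R f' k K u a b c u' v) => //=.
- exact: IH.
- by rewrite Symc_unchanged ?set2_sub.
- by rewrite om_U.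
- by rewrite join_unchanged.
- by rewrite isend_unchanged.
- by rewrite join_unchanged.
- by rewrite om_U.
Qed.

(** Tails only depend on their own edges and on the valences of the vertices. *)
Lemma is_tail_unchanged (K : {set edge f}) v : K \subset U ->
  @is_tail R f K v -> @is_tail R f' K v.
Proof.
move=> KU [k tl]; exists k; case: ifP tl => _; first exact: chain_tail_unchanged.
by case=> tl; [left; apply: end_tail_unchanged | right; apply: fork_tail_unchanged].
Qed.

End Unchanged.

(** * Moving values without changing the graph *)

Definition moved_copy (R : realType) (w l : seq R) (f f' : weighted_map R) : Prop :=
  exists (hV : vert f -> vert f') (hE : edge f -> edge f'),
    [/\ bijective hV, bijective hE,
        forall e, src (hE e) = hV (src e) /\ tgt (hE e) = hV (tgt e),
        forall x, phi (hV x) = relabel w l (phi x) & forall e, wt (hE e) = wt e].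

Section MovedCopy.
Variables (R : realType) (g : nat) (lambda mu : seq nat) (s t : nat).
Variables (w l : seq R) (z0 z : seq (branch R)).
Hypotheses (w_size : size w = s.*2 + t) (w_uniq : uniq w).
Hypothesis rg : regrouping s t z l.

Lemma moved_copy_iso f1 f2 f1' f2' ec1 ec2 X1 X2 :
  is_cover f1 g lambda mu z0 -> is_cover f2 g lambda mu z0 ->
  @split_cover R f1 s t w ec1 X1 -> @split_cover R f2 s t w ec2 X2 ->
  moved_copy w l f1 f1' -> moved_copy w l f2 f2' -> cover_iso f1' f2' -> cover_iso f1 f2.
Proof.
move=> c1 c2 sp1 sp2 [hV1 [hE1 [bV1 bE1 st1 p1 w1]]] [hV2 [hE2 [bV2 bE2 st2 p2 w2]]].
case=> hV [hE [bV bE st3 p3 w3]].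
have [kV hVK kVK] := bV2; have [kE hEK kEK] := bE2.
have bkV : bijective kV by exists hV2.
have bkE : bijective kE by exists hE2.
apply: (cover_iso_of_shape c1 c2 (hV := kV \o (hV \o hV1)) (hE := kE \o (hE \o hE1))).
- by apply: bij_comp bkV (bij_comp bV bV1).
- by apply: bij_comp bkE (bij_comp bE bE1).
split=> [e|e|x|e] /=.
- apply: (can_inj hVK); rewrite kVK; have [<- _] := st2 (kE (hE (hE1 e))).
  by rewrite kEK; have [-> _ _] := st3 (hE1 e); have [-> _] := st1 e.
- apply: (can_inj hVK); rewrite kVK; have [_ <-] := st2 (kE (hE (hE1 e))).
  by rewrite kEK; have [_ -> _] := st3 (hE1 e); have [_ ->] := st1 e.
- apply: (relabel_inj w_uniq (rg_uniq rg) (moved_size w_size rg)).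
  + exact: (split_values w_size w_uniq c2 sp2).
  + exact: (split_values w_size w_uniq c1 sp1).
  + by rewrite -p2 kVK p3 p1.
- by rewrite -w2 kEK w3 w1.
Qed.

End MovedCopy.

Section OrderPreserving.
Variables (R : realType) (g : nat) (lambda mu : seq nat) (s t : nat).
Variables (w l : seq R) (z : seq (branch R)) (f : weighted_map R).
Variables (ec : edge f) (X : pred (vert f)).
Notation z0 := (trivial_distribution s t w).
Hypotheses (w_size : size w = s.*2 + t) (w_uniq : uniq w).
Hypothesis w_mono : forall m n, m < n < s.*2 + t -> (nth 0%R w m < nth 0%R w n)%R.
Hypothesis cov : is_cover f g lambda mu z0.
Hypothesis sp : split_cover s t w ec X.
Hypothesis rg : regrouping s t z l.
Hypothesis ordered : (nth 0%R l 1 < nth 0%R l (s.*2 + t).-1)%R.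

Notation sigma := (relabel w l).
Let sigma_phi (x : vert f) := sigma (phi x).

Lemma moved_data : cover_data (@src R f) (@tgt R f) (@wt R f) sigma_phi.
Proof.
split.
- exact: leq_ltn_trans (leq0n _) (ltn_ord (src ec)).
- exact: curve_connected.
- exact: curve_leaf_inner.
- by rewrite /sigma_phi; case: cov => _ _ lf _ _ x /lf[] ->; [left | right].
- by move=> x ix; rewrite /sigma_phi relabel_fin (cover_fin cov).
- exact: cover_wt_gt0 cov.
- move=> e; have [->|ne] := eqVneq e ec; last exact: (moved_lt w_size w_uniq w_mono cov sp rg).
  rewrite /sigma_phi (split_phi_src sp) (split_phi_tgt sp) !relabel_nth ?w_size ?lte_fin //.
    by have := split_t sp; lia.
  by have := split_s sp; lia.
Qed.

Let f' := built moved_data.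

Lemma moved_is_cover : is_cover f' g lambda mu z.
Proof.
case: (cov) => hg [_ inj] _ _ [bal hl hm].
apply: built_is_cover => //.
- move=> r; rewrite -(moved_image w_size w_uniq cov sp rg r).
  by split=> [[x [_ ix px]]|[x ix px]]; exists x.
- by move=> x y ix iy /(moved_inj w_size w_uniq cov sp rg); apply: inj.
- rewrite (eq_filter (a2 := fun e => phi (src e) == -oo%E)) // => e.
  by rewrite /sigma_phi relabel_ninfty.
- rewrite (eq_filter (a2 := fun e => phi (tgt e) == +oo%E)) // => e.
  by rewrite /sigma_phi relabel_pinfty.
Qed.

(** Pairs correspond by position, so the same edges join the two vertices of a
    pair. *)
Lemma moved_contr : contr f' z = contr f z0.
Proof.
have pl := @pairs_listed_trivial _ s t w.
apply/setP => e; apply/idP/idP.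
  move=> /(contrP (rg_pairs rg))[j js [h1 h2]]; apply/(contrP pl (f := f)); exists j => //.
  split; apply/(moved_nth w_size w_uniq cov sp rg) => //; lia.
move=> /(contrP (f := f) pl)[j js [h1 h2]]; apply/(contrP (rg_pairs rg)); exists j => //.
split; apply/(moved_nth w_size w_uniq cov sp rg) => //; lia.
Qed.

Lemma moved_zigzag SV SE : resolving f z0 -> zigzag_subgraph (f := f) z0 SV SE ->
  exists f2, is_zigzag f2 g lambda mu z /\ moved_copy w l f f2.
Proof.
move=> res zz; exists f'; split; last first.
  by exists id, id; split=> //; exists id.
split; first exact: moved_is_cover.
- move=> p /(rg_pairs rg)[j js ->].
  have /res[v [v' [pv pv' forms]]] : inl (nth 0%R w j.*2, nth 0%R w j.*2.+1) \in z0.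
    by apply/(pairs_listed_trivial s t w); exists j.
  exists v, v'; split=> //.
    by apply/(moved_nth w_size w_uniq cov sp rg) => //; lia.
  by apply/(moved_nth w_size w_uniq cov sp rg) => //; lia.
- exists SV, SE; rewrite /zigzag_subgraph /Sym2 /nc_Sym /adj_contr moved_contr.
  case: zz => h1 h2 h3 h4 [h5 h6]; split=> //; split=> // e /h6[v [hv tl]]; exists v.
  split=> //; apply: (is_tail_unchanged (f := f) moved_data (U := [set: edge f]%SET)) tl => //.
Qed.

End OrderPreserving.

(** * Changing the graph around the cut edge *)

(** The surroundings of the cut edge [ec] of a properly mixed cover, from [c1] to
    [c2], as in the first picture at the top: the first pair is [c0], [c1], and
    [ei], [ej], [eo], [ek], [ea], [eh] are the edges i, j, o, k, a, h. *)
Record crossing (R : realType) (f : weighted_map R) := Crossing {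
  c0 : vert f; c1 : vert f; c2 : vert f;
  ei : edge f; ej : edge f; eo : edge f; ek : edge f;
  ec : edge f; ea : edge f; eh : edge f;
  cr_in0 : edge_in c0 = [set ei]; cr_out0 : edge_out c0 = [set eo; ek];
  cr_in1 : edge_in c1 = [set ek; ej]; cr_out1 : edge_out c1 = [set ec];
  cr_in2 : edge_in c2 = [set ec; ea]; cr_out2 : edge_out c2 = [set eh];
  cr_neq : [/\ eo != ek, ej != ek & ea != ec];
  cr_oc1 : tgt eo <> c1;
  cr_leaves : [/\ isleaf (src ei), isleaf (src ej) & isleaf (tgt eh)];
  cr_wt : wt ei = wt ej;
  cr_odd : [/\ odd (wt ei), odd (wt ec) & odd (wt ea)];
  cr_oa : eo != ea }.

(** Evaluates equality tests between edges which [neq] says to be distinct. *)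
Ltac decide_edges neq :=
  have [[? ? ? ? ?] [? ? ? ? ?] [? ? ? ? ?] [? ? ? ? ?] ?] := neq;
  repeat match goal with
  | |- context [?x == ?x] => rewrite (eqxx x)
  | H : is_true (?x != ?y) |- context [?x == ?y] => rewrite (negPf H)
  | H : is_true (?x != ?y) |- context [?y == ?x] => rewrite (eq_sym y x) (negPf H)
  end.

Section Twist.
Variables (R : realType) (f : weighted_map R) (D : crossing f).
Notation v0 := (c0 D).
Notation v1 := (c1 D).
Notation v2 := (c2 D).
Notation i := (ei D).
Notation j := (ej D).
Notation o := (eo D).
Notation k := (ek D).
Notation e12 := (ec D).
Notation a := (ea D).
Notation h := (eh D).

(** The twisted graph has the same vertices and edges as the old one and only
    differs in these three functions; compare the second picture at the top. *)
Definition tsrc (e : edge f) : vert f :=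
  if e == k then v2 else if e == e12 then v0 else if e == h then v1 else src e.
Definition ttgt (e : edge f) : vert f :=
  if (e == i) || (e == j) then v2 else if e == k then v0
  else if (e == e12) || (e == a) then v1 else tgt e.
Definition twt (e : edge f) : nat := if e == k then (wt i).*2 else wt e.

Definition fixed_edges : {set edge f} := ~: [set i; j; k; e12; a; h].

Lemma src0 e : (src e == v0) = (e == o) || (e == k).
Proof. by have := cr_out0 D; move/setP/(_ e); rewrite !inE. Qed.
Lemma src1 e : (src e == v1) = (e == e12).
Proof. by have := cr_out1 D; move/setP/(_ e); rewrite !inE. Qed.
Lemma src2 e : (src e == v2) = (e == h).
Proof. by have := cr_out2 D; move/setP/(_ e); rewrite !inE. Qed.
Lemma tgt0 e : (tgt e == v0) = (e == i).
Proof. by have := cr_in0 D; move/setP/(_ e); rewrite !inE. Qed.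
Lemma tgt1 e : (tgt e == v1) = (e == k) || (e == j).
Proof. by have := cr_in1 D; move/setP/(_ e); rewrite !inE. Qed.
Lemma tgt2 e : (tgt e == v2) = (e == e12) || (e == a).
Proof. by have := cr_in2 D; move/setP/(_ e); rewrite !inE. Qed.

Lemma src_o : src o = v0. Proof. by apply/eqP; rewrite src0 eqxx. Qed.
Lemma src_k : src k = v0. Proof. by apply/eqP; rewrite src0 eqxx orbT. Qed.
Lemma src_e12 : src e12 = v1. Proof. by apply/eqP; rewrite src1. Qed.
Lemma src_h : src h = v2. Proof. by apply/eqP; rewrite src2. Qed.
Lemma tgt_i : tgt i = v0. Proof. by apply/eqP; rewrite tgt0. Qed.
Lemma tgt_j : tgt j = v1. Proof. by apply/eqP; rewrite tgt1 eqxx orbT. Qed.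
Lemma tgt_k : tgt k = v1. Proof. by apply/eqP; rewrite tgt1 eqxx. Qed.
Lemma tgt_e12 : tgt e12 = v2. Proof. by apply/eqP; rewrite tgt2 eqxx. Qed.
Lemma tgt_a : tgt a = v2. Proof. by apply/eqP; rewrite tgt2 eqxx orbT. Qed.

Variables (g : nat) (lambda mu : seq nat) (zc : seq (branch R)).
Hypothesis cov : is_cover f g lambda mu zc.

Lemma v0v1 : v0 != v1.
Proof. by have := cover_noloop cov k; rewrite src_k tgt_k. Qed.
Lemma v1v2 : v1 != v2.
Proof. by have := cover_noloop cov e12; rewrite src_e12 tgt_e12. Qed.
Lemma v0v2 : v0 != v2.
Proof.
apply/eqP => h02; have := cover_lt cov k; have := cover_lt cov e12.
rewrite src_k tgt_k src_e12 tgt_e12 -h02 => h1 h2.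
by have := lt_trans h1 h2; rewrite ltxx.
Qed.

Lemma out_in_card : [/\ #|edge_out v0| = 2 /\ #|edge_in v0| = 1,
  #|edge_out v1| = 1 /\ #|edge_in v1| = 2 & #|edge_out v2| = 1 /\ #|edge_in v2| = 2].
Proof.
have [h1 h2 h3] := cr_neq D.
rewrite (cr_in0 D) (cr_in1 D) (cr_in2 D) (cr_out0 D) (cr_out1 D) (cr_out2 D).
by rewrite !cards1 !cards2 h1 (eq_sym _ j) h2 (eq_sym _ a) h3.
Qed.

Lemma inner0 : isinner v0.
Proof. by rewrite innerE; have [[-> ->] _ _] := out_in_card. Qed.
Lemma inner1 : isinner v1.
Proof. by rewrite innerE; have [_ [-> ->] _] := out_in_card. Qed.
Lemma inner2 : isinner v2.
Proof. by rewrite innerE; have [_ _ [-> ->]] := out_in_card. Qed.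

Lemma leaf_neq x y : isleaf x -> isinner y -> x != y :> vert f.
Proof. by rewrite isleafN => /negP nx iy; apply/eqP => xy; apply: nx; rewrite xy. Qed.

Lemma edges_neq : [/\
  [/\ i != j, i != o, i != k, i != e12 & i != a],
  [/\ i != h, j != o, j != k, j != e12 & j != a],
  [/\ j != h, o != k, o != e12, o != a & o != h],
  [/\ k != e12, k != a, k != h, e12 != a & e12 != h] & a != h].
Proof.
have by_src e e' : src e != src e' -> e != e' by apply: contraNneq => ->.
have by_tgt e e' : tgt e != tgt e' -> e != e' by apply: contraNneq => ->.
have [li lj lh] := cr_leaves D; have [n1 n2 n3] := cr_neq D; have n4 := cr_oa D.
have n5 := v0v1; have n6 := v0v2; have n7 := v1v2.
do !split=> //; first
  [ by apply: by_tgt; rewrite ?tgt_i ?tgt_j ?tgt_k ?tgt_e12 ?tgt_a // eq_sym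
  | by apply: by_src; rewrite ?src_o ?src_k ?src_e12 ?src_h // eq_sym
  | by apply: by_src; rewrite ?src_o ?src_k ?src_e12 ?src_h; apply: leaf_neq;
       rewrite ?inner0 ?inner1 ?inner2
  | by apply: by_tgt; rewrite eq_sym; apply: leaf_neq;
       rewrite ?tgt_i ?tgt_j ?tgt_k ?tgt_e12 ?tgt_a ?inner0 ?inner1 ?inner2
  | by rewrite eq_sym ].
Qed.

Lemma fixedP e : reflect [/\ [/\ e != i, e != j & e != k], e != e12, e != a & e != h]
  (e \in fixed_edges).
Proof.
rewrite !inE !negb_or -!andbA.
by apply: (iffP and5P) => [[-> -> -> ->/andP[]]|[[-> -> ->] -> -> ->]].
Qed.

Lemma fixed_src e : e \in fixed_edges -> tsrc e = src e.
Proof. by case/fixedP=> [[_ _ hk] h12 ha hh]; rewrite /tsrc (negPf hk) (negPf h12) (negPf hh). Qed.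

Lemma fixed_tgt e : e \in fixed_edges -> ttgt e = tgt e.
Proof.
case/fixedP=> [[hi hj hk] h12 ha hh].
by rewrite /ttgt (negPf hi) (negPf hj) (negPf hk) (negPf h12) (negPf ha).
Qed.

Lemma fixed_wt e : e \in fixed_edges -> twt e = wt e.
Proof. by case/fixedP=> [[_ _ hk] _ _ _]; rewrite /twt (negPf hk). Qed.

Lemma edgeP (e : edge f) (Q : edge f -> Prop) :
  Q i -> Q j -> Q k -> Q e12 -> Q a -> Q h -> (e \in fixed_edges -> Q e) -> Q e.
Proof.
move=> Qi Qj Qk Q12 Qa Qh Qe.
have [->//|ni] := eqVneq e i; have [->//|nj] := eqVneq e j; have [->//|nk] := eqVneq e k.
have [->//|n12] := eqVneq e e12; have [->//|na] := eqVneq e a; have [->//|nh] := eqVneq e h.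
by apply: Qe; apply/fixedP.
Qed.

Lemma tsrc_E : [/\ tsrc k = v2, tsrc e12 = v0, tsrc h = v1 &
  [/\ tsrc i = src i, tsrc j = src j, tsrc o = v0 & tsrc a = src a]].
Proof. by rewrite -{2}src_o /tsrc; decide_edges edges_neq. Qed.

Lemma ttgt_E : [/\ ttgt i = v2, ttgt j = v2, ttgt k = v0 &
  [/\ ttgt e12 = v1, ttgt a = v1, ttgt o = tgt o & ttgt h = tgt h]].
Proof. by rewrite /ttgt; decide_edges edges_neq. Qed.

Lemma twt_E : [/\ twt i = wt i, twt j = wt i, twt o = wt o &
  [/\ twt k = (wt i).*2, twt e12 = wt e12, twt a = wt a & twt h = wt h]].
Proof. by rewrite /twt; decide_edges edges_neq; rewrite (cr_wt D). Qed.

End Twist.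

Lemma sum_set2 (T : finType) (x y : T) (F : T -> nat) : x != y ->
  \sum_(e in [set x; y]) F e = F x + F y.
Proof.
move=> xy; rewrite (bigD1 x) ?inE ?eqxx //= (bigD1 y) ?inE ?eqxx ?orbT ?(eq_sym y) //=.
by rewrite big1 ?addn0 // => e; rewrite !inE => /andP[/andP[/orP[]->]].
Qed.

Lemma connect_closed (T : finType) (r : rel T) (W : pred T) x y :
  (forall u v, W u -> r u v -> W v) -> W x -> connect r x y -> W y.
Proof.
move=> cl Wx /connectP[p]; elim: p x Wx => [|u p IH] x Wx /=; first by move=> _ ->.
by case/andP=> /(cl _ _ Wx) Wu; apply: IH.
Qed.

Lemma connect_closed_eq (T : finType) (r r' : rel T) (W : pred T) x y :
  (forall u v, W u -> r' u v = r u v) -> (forall u v, W u -> r u v -> W v) ->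
  W x -> connect r' x y = connect r x y.
Proof.
move=> rr cl Wx; apply/idP/idP => /connectP[p]; elim: p x Wx => [|u p IH] x Wx /=;
  try by move=> _ ->; apply: connect0.
  rewrite rr // => /andP[xu hp] hl; apply: connect_trans (connect1 xu) _.
  by apply: IH => //; apply: cl xu.
case/andP=> xu hp hl; apply: connect_trans (connect1 (_ : r' x u)) _; first by rewrite rr.
by apply: IH => //; apply: cl xu.
Qed.

Section TwistGraph.
Variables (R : realType) (f : weighted_map R) (D : crossing f).
Notation v0 := (c0 D).
Notation v1 := (c1 D).
Notation v2 := (c2 D).
Notation i := (ei D).
Notation j := (ej D).
Notation o := (eo D).
Notation k := (ek D).
Notation e12 := (ec D).
Notation a := (ea D).
Notation h := (eh D).
Notation U := (fixed_edges D).
Notation sr := (tsrc D).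
Notation tg := (ttgt D).
Notation om := (twt D).
Variables (g : nat) (lambda mu : seq nat) (zc : seq (branch R)).
Hypothesis cov : is_cover f g lambda mu zc.

Let TS := tsrc_E D cov.
Let TT := ttgt_E D cov.
Let NE := edges_neq D cov.

Lemma tsrc0 e : (sr e == v0) = (e == o) || (e == e12).
Proof.
have [h1 h2 h3 [h4 h5 h6 h7]] := TS.
have n1 := negbTE (v0v1 D cov); have n2 := negbTE (v0v2 D cov).
pattern e; apply: (@edgeP _ f D).
- by rewrite h4 (src0 D); decide_edges NE.
- by rewrite h5 (src0 D); decide_edges NE.
- by rewrite h1 eq_sym n2; decide_edges NE.
- by rewrite h2 !eqxx orbT.
- by rewrite h7 (src0 D); decide_edges NE.
- by rewrite h3 eq_sym n1; decide_edges NE.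
- by move=> /[dup] eU /fixedP[[_ _ ek] e12_ _ _]; rewrite fixed_src // src0 (negPf ek) (negPf e12_).
Qed.

Lemma tsrc1 e : (sr e == v1) = (e == h).
Proof.
have [h1 h2 h3 [h4 h5 h6 h7]] := TS.
have n1 := negbTE (v0v1 D cov); have n2 := negbTE (v1v2 D cov).
pattern e; apply: (@edgeP _ f D).
- by rewrite h4 (src1 D); decide_edges NE.
- by rewrite h5 (src1 D); decide_edges NE.
- by rewrite h1 eq_sym n2; decide_edges NE.
- by rewrite h2 n1; decide_edges NE.
- by rewrite h7 (src1 D); decide_edges NE.
- by rewrite h3 !eqxx.
- by move=> /[dup] eU /fixedP[[_ _ ek] e12_ _ eh]; rewrite fixed_src // src1 (negPf eh) (negPf e12_).
Qed.

Lemma tsrc2 e : (sr e == v2) = (e == k).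
Proof.
have [h1 h2 h3 [h4 h5 h6 h7]] := TS.
have n1 := negbTE (v0v2 D cov); have n2 := negbTE (v1v2 D cov).
pattern e; apply: (@edgeP _ f D).
- by rewrite h4 (src2 D); decide_edges NE.
- by rewrite h5 (src2 D); decide_edges NE.
- by rewrite h1 !eqxx.
- by rewrite h2 n1; decide_edges NE.
- by rewrite h7 (src2 D); decide_edges NE.
- by rewrite h3 n2; decide_edges NE.
- by move=> /[dup] eU /fixedP[[_ _ ek] e12_ _ eh]; rewrite fixed_src // src2 (negPf eh) (negPf ek).
Qed.

Lemma ttgt0 e : (tg e == v0) = (e == k).
Proof.
have [h1 h2 h3 [h4 h5 h6 h7]] := TT.
have n1 := negbTE (v0v2 D cov); have n2 := negbTE (v0v1 D cov).
pattern e; apply: (@edgeP _ f D).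
- by rewrite h1 eq_sym n1; decide_edges NE.
- by rewrite h2 eq_sym n1; decide_edges NE.
- by rewrite h3 !eqxx.
- by rewrite h4 eq_sym n2; decide_edges NE.
- by rewrite h5 eq_sym n2; decide_edges NE.
- by rewrite h7 (tgt0 D); decide_edges NE.
- by move=> /[dup] eU /fixedP[[ei _ ek] _ _ _]; rewrite fixed_tgt // tgt0 (negPf ei) (negPf ek).
Qed.

Lemma ttgt1 e : (tg e == v1) = (e == e12) || (e == a).
Proof.
have [h1 h2 h3 [h4 h5 h6 h7]] := TT.
have n1 := negbTE (v1v2 D cov); have n2 := negbTE (v0v1 D cov).
pattern e; apply: (@edgeP _ f D).
- by rewrite h1 eq_sym n1; decide_edges NE.
- by rewrite h2 eq_sym n1; decide_edges NE.
- by rewrite h3 n2; decide_edges NE.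
- by rewrite h4 !eqxx.
- by rewrite h5 !eqxx orbT.
- by rewrite h7 (tgt1 D); decide_edges NE.
- by move=> /[dup] eU /fixedP[[ei ej ek] e_ ea _];
     rewrite fixed_tgt // tgt1 (negPf ej) (negPf ek) (negPf e_) (negPf ea).
Qed.

Lemma ttgt2 e : (tg e == v2) = (e == i) || (e == j).
Proof.
have [h1 h2 h3 [h4 h5 h6 h7]] := TT.
have n1 := negbTE (v1v2 D cov); have n2 := negbTE (v0v2 D cov).
pattern e; apply: (@edgeP _ f D).
- by rewrite h1 !eqxx.
- by rewrite h2 !eqxx orbT.
- by rewrite h3 n2; decide_edges NE.
- by rewrite h4 n1; decide_edges NE.
- by rewrite h5 n1; decide_edges NE.
- by rewrite h7 (tgt2 D); decide_edges NE.
- by move=> /[dup] eU /fixedP[[ei ej ek] e_ ea _];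
     rewrite fixed_tgt // tgt2 (negPf ei) (negPf ej) (negPf e_) (negPf ea).
Qed.

Lemma tsrc_other x e : [/\ x != v0, x != v1 & x != v2] -> (sr e == x) = (src e == x).
Proof.
case=> n0 n1 n2; have [h1 h2 h3 [h4 h5 h6 h7]] := TS.
pattern e; apply: (@edgeP _ f D); rewrite ?h1 ?h2 ?h3 ?h4 ?h5 ?h7 //.
- by rewrite src_k ![_ == x]eq_sym (negPf n2) (negPf n0).
- by rewrite src_e12 ![_ == x]eq_sym (negPf n1) (negPf n0).
- by rewrite src_h ![_ == x]eq_sym (negPf n1) (negPf n2).
- by move=> eU; rewrite fixed_src.
Qed.

Lemma ttgt_other x e : [/\ x != v0, x != v1 & x != v2] -> (tg e == x) = (tgt e == x).
Proof.
case=> n0 n1 n2; have [h1 h2 h3 [h4 h5 h6 h7]] := TT.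
pattern e; apply: (@edgeP _ f D); rewrite ?h1 ?h2 ?h3 ?h4 ?h5 ?h7 //.
- by rewrite tgt_i ![_ == x]eq_sym (negPf n2) (negPf n0).
- by rewrite tgt_j ![_ == x]eq_sym (negPf n2) (negPf n1).
- by rewrite tgt_k ![_ == x]eq_sym (negPf n1) (negPf n0).
- by rewrite tgt_e12 ![_ == x]eq_sym (negPf n1) (negPf n2).
- by rewrite tgt_a ![_ == x]eq_sym (negPf n1) (negPf n2).
- by move=> eU; rewrite fixed_tgt.
Qed.

Lemma twist_vertP (x : vert f) (Q : vert f -> Prop) :
  Q v0 -> Q v1 -> Q v2 -> ([/\ x != v0, x != v1 & x != v2] -> Q x) -> Q x.
Proof.
move=> q0 q1 q2 q.
have [->//|n0] := eqVneq x v0; have [->//|n1] := eqVneq x v1; have [->//|n2] := eqVneq x v2.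
exact: q.
Qed.

(** All valences are preserved, and so are the leaves and the inner vertices. *)
Lemma twist_card x : #|[set e | sr e == x]| = #|edge_out x| /\ #|[set e | tg e == x]| = #|edge_in x|.
Proof.
have [_ _ [_ _ o12 _ _] [_ _ _ e12a _] _] := edges_neq D cov.
have [[ij _ _ _ _] _ _ _ _] := edges_neq D cov.
have [h1 h2 h3] := out_in_card D.
have card2 (F : pred (edge f)) b c : (forall e, F e = (e == b) || (e == c)) -> b != c ->
    #|[set e | F e]| = 2.
  move=> hF bc; rewrite (_ : [set e | F e] = [set b; c]) ?cards2 ?bc //.
  by apply/setP => e; rewrite !inE.
have card1 (F : pred (edge f)) b : (forall e, F e = (e == b)) -> #|[set e | F e]| = 1.
  move=> hF; rewrite (_ : [set e | F e] = [set b]) ?cards1 //.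
  by apply/setP => e; rewrite !inE.
pattern x; apply: twist_vertP.
- by case: h1 => -> ->; rewrite (card2 _ _ _ tsrc0 o12) (card1 _ _ ttgt0).
- by case: h2 => -> ->; rewrite (card1 _ _ tsrc1) (card2 _ _ _ ttgt1 e12a).
- by case: h3 => -> ->; rewrite (card1 _ _ tsrc2) (card2 _ _ _ ttgt2 ij).
- move=> nx; split; congr #|pred_of_set _|; apply/setP => e; rewrite !inE.
    by rewrite tsrc_other.
  by rewrite ttgt_other.
Qed.

Lemma twist_valence x : valence sr tg x = valence (@src R f) (@tgt R f) x.
Proof. by rewrite /valence; have [-> ->] := twist_card x. Qed.

Lemma twist_inner x : inner sr tg x = isinner x.
Proof. by rewrite /inner twist_valence. Qed.

Lemma twist_leaf x : leaf sr tg x = isleaf x.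
Proof. by rewrite /leaf twist_valence. Qed.

Lemma twist_adj_sym (A : {set edge f}) : connect_sym (adj_in sr tg A).
Proof.
apply: sym_connect_sym => x y; apply: eq_existsb => e.
by rewrite /joins orbC.
Qed.

Lemma twist_step (A : {set edge f}) e : e \in A ->
  fingraph.root (adj_in sr tg A) (sr e) = fingraph.root (adj_in sr tg A) (tg e).
Proof.
move=> eA; apply/(fingraph.rootP (twist_adj_sym A)); apply: connect1.
by apply/existsP; exists e; rewrite eA /joins !eqxx.
Qed.

(** Contracting the new edges identifies the end points of every old edge, so the
    new graph is connected because the old one is. *)
Lemma twist_connected x y : connect (adj_in sr tg [set: edge f]) x y.
Proof.
set r := fingraph.root (adj_in sr tg [set: edge f]).
have st e : r (sr e) = r (tg e) by apply: twist_step; rewrite inE.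
have [h1 h2 h3 [h4 h5 h6 h7]] := TS; have [t1 t2 t3 [t4 t5 t6 t7]] := TT.
have s1 := st i; rewrite h4 t1 in s1. have s2 := st j; rewrite h5 t2 in s2.
have s3 := st k; rewrite h1 t3 in s3. have s4 := st e12; rewrite h2 t4 in s4.
have s5 := st a; rewrite h7 t5 in s5. have s6 := st h; rewrite h3 t7 in s6.
have old e : r (src e) = r (tgt e).
  pattern e; apply: (@edgeP _ f D).
  - by rewrite tgt_i s1 s3.
  - by rewrite tgt_j s2 s3 s4.
  - by rewrite src_k tgt_k s4.
  - by rewrite src_e12 tgt_e12 s3 s4.
  - by rewrite tgt_a s5 s3 s4.
  - by rewrite src_h s3 s4 s6.
  - by move=> eU; rewrite -(fixed_src eU) -(fixed_tgt eU).
apply/(fingraph.rootP (twist_adj_sym _)); rewrite -/r.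
case/connectP: (curve_connected x y) => p; elim: p x => [|z p IH] x /= => [_ ->|] //.
case/andP=> /existsP[e /andP[_ /orP[]/andP[/eqP <- /eqP <-]]] hp hl.
  by rewrite old; apply: IH.
by rewrite -old; apply: IH.
Qed.

Lemma balance_old : [/\ wt i = wt o + wt k, wt k + wt j = wt e12 & wt e12 + wt a = wt h].
Proof.
have [n1 n2 n3] := cr_neq D; case: cov => _ _ _ _ [bal _ _]; split.
- by have := bal _ (inner0 D); rewrite (cr_in0 D) (cr_out0 D) sum_set2 // big_set1.
- by have := bal _ (inner1 D); rewrite (cr_in1 D) (cr_out1 D) sum_set2 1?eq_sym // big_set1.
- by have := bal _ (inner2 D); rewrite (cr_in2 D) (cr_out2 D) sum_set2 1?eq_sym // big_set1.
Qed.

End TwistGraph.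

(** * The twisted cover *)

Section TwistCover.
Variables (R : realType) (f : weighted_map R) (D : crossing f).
Notation v0 := (c0 D).
Notation v1 := (c1 D).
Notation v2 := (c2 D).
Notation i := (ei D).
Notation j := (ej D).
Notation o := (eo D).
Notation k := (ek D).
Notation e12 := (ec D).
Notation a := (ea D).
Notation h := (eh D).
Notation U := (fixed_edges D).
Notation sr := (tsrc D).
Notation tg := (ttgt D).
Notation om := (twt D).
Variables (g : nat) (lambda mu : seq nat) (s t : nat).
Variables (w l : seq R) (z : seq (branch R)).
Variable X : pred (vert f).
Notation z0 := (trivial_distribution s t w).
Hypotheses (w_size : size w = s.*2 + t) (w_uniq : uniq w).
Hypothesis w_mono : forall m n, m < n < s.*2 + t -> (nth 0%R w m < nth 0%R w n)%R.
Hypothesis cov : is_cover f g lambda mu z0.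
Hypothesis sp : split_cover s t w e12 X.
Hypothesis rg : regrouping s t z l.
Hypothesis phi_v0 : phi v0 = (nth 0%R w 0)%:E.
Hypothesis rev : (nth 0%R l (s.*2 + t).-1 < nth 0%R l 0)%R.

Notation sigma := (relabel w l).
Let ph (x : vert f) := sigma (phi x).
Let TS := tsrc_E D cov.
Let TT := ttgt_E D cov.
Let TW := twt_E D cov.
Let NE := edges_neq D cov.

Lemma phi_v1 : phi v1 = (nth 0%R w 1)%:E.
Proof. by rewrite -(split_phi_src sp) src_e12. Qed.

Lemma phi_v2 : phi v2 = (nth 0%R w (s.*2 + t).-1)%:E.
Proof. by rewrite -(split_phi_tgt sp) tgt_e12. Qed.

Lemma ph_v0 : ph v0 = (nth 0%R l 0)%:E.
Proof. by rewrite /ph phi_v0 relabel_nth ?w_size //; have := split_s sp; lia. Qed.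

Lemma ph_v1 : ph v1 = (nth 0%R l 1)%:E.
Proof. by rewrite /ph phi_v1 relabel_nth ?w_size //; have := split_s sp; lia. Qed.

Lemma ph_v2 : ph v2 = (nth 0%R l (s.*2 + t).-1)%:E.
Proof. by rewrite /ph phi_v2 relabel_nth ?w_size //; have := split_s sp; lia. Qed.

Lemma X_v2 : ~~ X v2. Proof. by rewrite -tgt_e12; apply: split_tgt sp. Qed.
Lemma X_src_a : ~~ X (src a).
Proof.
have := split_side sp (e := a); rewrite tgt_a => -> //; first exact: X_v2.
by decide_edges NE.
Qed.

Lemma src_i_ninfty : phi (src i) = -oo%E.
Proof. by apply: (cover_src_leaf cov); have [] := cr_leaves D. Qed.
Lemma src_j_ninfty : phi (src j) = -oo%E.
Proof. by apply: (cover_src_leaf cov); have [] := cr_leaves D. Qed.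
Lemma tgt_h_pinfty : phi (tgt h) = +oo%E.
Proof. by apply: (cover_tgt_leaf cov); have [] := cr_leaves D. Qed.

Lemma lt_l01 : (nth 0%R l 0 < nth 0%R l 1)%R.
Proof. by apply: (rg_low rg); have := split_s sp; lia. Qed.

Lemma twist_lt e : (ph (sr e) < ph (tg e))%E.
Proof.
have [h1 h2 h3 [h4 h5 h6 h7]] := TS; have [t1 t2 t3 [t4 t5 t6 t7]] := TT.
pattern e; apply: (@edgeP _ f D).
- by rewrite h4 t1 ph_v2 /ph src_i_ninfty ltNyr.
- by rewrite h5 t2 ph_v2 /ph src_j_ninfty ltNyr.
- by rewrite h1 t3 ph_v2 ph_v0 lte_fin.
- by rewrite h2 t4 ph_v1 ph_v0 lte_fin lt_l01.
- rewrite h7 t5 ph_v1; have : a != e12 by decide_edges NE.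
  move/(moved_lt w_size w_uniq w_mono cov sp rg); rewrite tgt_a => /lt_trans; apply.
  by rewrite -/(ph v2) ph_v2 lte_fin (lt_trans rev lt_l01).
- by rewrite h3 t7 ph_v1 /ph tgt_h_pinfty /= ltry.
- move=> eU; rewrite fixed_src // fixed_tgt //.
  apply: (moved_lt w_size w_uniq w_mono cov sp rg).
  by case/fixedP: eU.
Qed.

Lemma twist_data : cover_data sr tg om ph.
Proof.
split.
- exact: leq_ltn_trans (leq0n _) (ltn_ord v0).
- exact: (twist_connected D cov).
- by move=> x; rewrite (twist_leaf D cov) (twist_inner D cov); exact: curve_leaf_inner.
- move=> x; rewrite (twist_leaf D cov) /ph; case: cov => _ _ lf _ _ /lf[] ->; first by left.
  by right.
- by move=> x; rewrite (twist_inner D cov) /ph relabel_fin (cover_fin cov).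
- by move=> e; rewrite /twt; case: ifP => _; rewrite ?double_gt0 (cover_wt_gt0 cov).
- exact: twist_lt.
Qed.

Let f' := built twist_data.

Lemma twist_isinner x : @isinner R f' x = @isinner R f x.
Proof. exact: (twist_inner D cov). Qed.

Lemma twist_in0 : @edge_in R f' v0 = [set k].
Proof. by apply/setP => e; rewrite !inE; exact: (ttgt0 D cov). Qed.
Lemma twist_in1 : @edge_in R f' v1 = [set e12; a].
Proof. by apply/setP => e; rewrite !inE; exact: (ttgt1 D cov). Qed.
Lemma twist_in2 : @edge_in R f' v2 = [set i; j].
Proof. by apply/setP => e; rewrite !inE; exact: (ttgt2 D cov). Qed.
Lemma twist_out0 : @edge_out R f' v0 = [set o; e12].
Proof. by apply/setP => e; rewrite !inE; exact: (tsrc0 D cov). Qed.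
Lemma twist_out1 : @edge_out R f' v1 = [set h].
Proof. by apply/setP => e; rewrite !inE; exact: (tsrc1 D cov). Qed.
Lemma twist_out2 : @edge_out R f' v2 = [set k].
Proof. by apply/setP => e; rewrite !inE; exact: (tsrc2 D cov). Qed.

Lemma twist_in_other x : [/\ x != v0, x != v1 & x != v2] -> @edge_in R f' x = @edge_in R f x.
Proof. by move=> nx; apply/setP => e; rewrite !inE; exact: (ttgt_other cov _ nx). Qed.
Lemma twist_out_other x : [/\ x != v0, x != v1 & x != v2] -> @edge_out R f' x = @edge_out R f x.
Proof. by move=> nx; apply/setP => e; rewrite !inE; exact: (tsrc_other cov _ nx). Qed.

Lemma twist_balance (x : vert f') : isinner x ->
  \sum_(e in edge_in x) wt e = \sum_(e in edge_out x) wt e.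
Proof.
rewrite twist_isinner; have [b0 b1 b2] := balance_old D cov; have wij := cr_wt D.
have [w1 w2 w3 [w4 w5 w6 w7]] := TW.
have [_ _ [_ _ o12 _ _] [_ _ _ e12a _] _] := NE; have [[ij _ _ _ _] _ _ _ _] := NE.
pattern x; apply: (@twist_vertP _ f D) => [_|_|_|nx ix].
- rewrite twist_in0 twist_out0 big_set1 sum_set2 //= w4 w3 w5; lia.
- rewrite twist_in1 twist_out1 big_set1 sum_set2 //= w7 w6 w5; lia.
- rewrite twist_in2 twist_out2 big_set1 sum_set2 //= w4 w1 w2; lia.
rewrite twist_in_other // twist_out_other //; case: cov => _ _ _ _ [/(_ x ix) bal _ _].
have [n0 n1 _] := nx.
have nk (e : edge f) : (@src R f e == x) || (@tgt R f e == x) -> e != k.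
  by apply: contraTneq => ->; rewrite src_k tgt_k ![_ == x]eq_sym negb_or n0 n1.
have twE (e : edge f) : (@src R f e == x) || (@tgt R f e == x) -> om e = wt e by rewrite /twt => /nk/negPf->.
transitivity (\sum_(e in @edge_in R f x) @wt R f e).
  by apply: eq_bigr => e; rewrite inE => ex; apply: twE; rewrite ex orbT.
rewrite bal; apply: eq_bigr => e; rewrite inE => ex; apply/esym/twE.
by rewrite ex.
Qed.

Lemma twist_is_cover : is_cover f' g lambda mu z.
Proof.
case: (cov) => hg [_ inj] _ _ [_ hl hm].
have [h1 h2 h3 [h4 h5 h6 h7]] := TS; have [t1 t2 t3 [t4 t5 t6 t7]] := TT.
have fin n : ((nth 0%R l n)%:E == -oo%E :> \bar R) = false by [].
have finp n : ((nth 0%R l n)%:E == +oo%E :> \bar R) = false by [].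
have srcE e : (ph (sr e) == -oo%E) = (phi (src e) == -oo%E).
  pattern e; apply: (@edgeP _ f D); rewrite ?h1 ?h2 ?h3 ?h4 ?h5 ?h7 /ph ?relabel_ninfty //.
  - by rewrite src_k phi_v2 phi_v0.
  - by rewrite src_e12 phi_v0 phi_v1.
  - by rewrite src_h phi_v1 phi_v2.
  - by move=> eU; rewrite fixed_src.
have tgtE e : (ph (tg e) == +oo%E) = (phi (tgt e) == +oo%E).
  pattern e; apply: (@edgeP _ f D); rewrite ?t1 ?t2 ?t3 ?t4 ?t5 ?t7 /ph ?relabel_pinfty //.
  - by rewrite tgt_i phi_v2 phi_v0.
  - by rewrite tgt_j phi_v2 phi_v1.
  - by rewrite tgt_k phi_v1 phi_v0.
  - by rewrite tgt_e12 phi_v1 phi_v2.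
  - by rewrite tgt_a phi_v1 phi_v2.
  - by move=> eU; rewrite fixed_tgt.
apply: built_is_cover => //.
- move=> r; rewrite -(moved_image w_size w_uniq cov sp rg r).
  split=> [[x [_ ix px]]|[x ix px]]; exists x => //.
    by rewrite twist_isinner in ix.
  by split=> //; rewrite twist_isinner.
- move=> x y; rewrite -!topredE /= !twist_isinner => ix iy.
  by move/(moved_inj w_size w_uniq cov sp rg); apply: inj.
- exact: twist_balance.
- rewrite (eq_filter srcE) (_ : [seq om e | e <- _] =
    [seq wt e | e <- enum (edge f) & phi (src e) == -oo%E]) //.
  apply/eq_in_map => e; rewrite mem_filter /twt => /andP[pe _]; case: eqP => // ek.
  by move: pe; rewrite ek src_k phi_v0.
- rewrite (eq_filter tgtE) (_ : [seq om e | e <- _] =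
    [seq wt e | e <- enum (edge f) & phi (tgt e) == +oo%E]) //.
  apply/eq_in_map => e; rewrite mem_filter /twt => /andP[pe _]; case: eqP => // ek.
  by move: pe; rewrite ek tgt_k phi_v1.
Qed.

Lemma nth_w_inj m n : m < s.*2 + t -> n < s.*2 + t ->
  (nth 0%R w m)%:E = (nth 0%R w n)%:E :> \bar R -> m = n.
Proof. by move=> hm hn [] /eqP; rewrite nth_uniq ?w_size // => /eqP. Qed.

Lemma nth_l_inj m n : m < s.*2 + t -> n < s.*2 + t ->
  (nth 0%R l m)%:E = (nth 0%R l n)%:E :> \bar R -> m = n.
Proof. by move=> hm hn [] /eqP; rewrite nth_uniq ?(rg_size rg) ?(rg_uniq rg) // => /eqP. Qed.

Let pl := @pairs_listed_trivial _ s t w.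

Lemma k_contr : k \in contr f z0.
Proof.
by apply/(contrP pl (f := f)); exists 0; rewrite ?(split_s sp) // src_k tgt_k phi_v0 phi_v1.
Qed.

Lemma contr_old e : e \in contr f z0 -> e \in U \/ e = k.
Proof.
have s0 := split_s sp; have t0 := split_t sp.
move/(contrP pl (f := f)) => [n ns []]; pattern e; apply: (@edgeP _ f D).
- by rewrite src_i_ninfty.
- by rewrite src_j_ninfty.
- by move=> _ _; right.
- by rewrite tgt_e12 phi_v2 => _ /nth_w_inj; lia.
- by rewrite tgt_a phi_v2 => _ /nth_w_inj; lia.
- by rewrite tgt_h_pinfty.
- by left.
Qed.

Lemma contr_fixed e : e \in U -> (e \in contr f' z) = (e \in contr f z0).
Proof.
move=> eU; apply/idP/idP.
  move=> /(contrP (rg_pairs rg))[n ns []] /=; rewrite fixed_src // fixed_tgt // => p1 p2.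
  apply/(contrP pl (f := f)); exists n => //.
  split; apply/(moved_nth w_size w_uniq cov sp rg) => //; lia.
move=> /(contrP (f := f) pl)[n ns [p1 p2]]; apply/(contrP (rg_pairs rg)); exists n => //=.
rewrite fixed_src // fixed_tgt //.
split; apply/(moved_nth w_size w_uniq cov sp rg) => //; lia.
Qed.

Lemma e12_contr : e12 \in contr f' z.
Proof.
have [_ h2 _ _] := TS; have [_ _ _ [t4 _ _ _]] := TT.
apply/(contrP (rg_pairs rg)); exists 0; first exact: split_s sp.
by rewrite /= h2 t4 ph_v0 ph_v1.
Qed.

Lemma contr_new e : e \in contr f' z -> e \in U \/ e = e12.
Proof.
have [h1 h2 h3 [h4 h5 h6 h7]] := TS; have [t1 t2 t3 [t4 t5 t6 t7]] := TT.
have s0 := split_s sp; have t0 := split_t sp.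
move/(contrP (rg_pairs rg)) => [n ns []] /=; pattern e; apply: (@edgeP _ f D).
- by rewrite h4 /ph src_i_ninfty.
- by rewrite h5 /ph src_j_ninfty.
- by rewrite h1 ph_v2 => /nth_l_inj; lia.
- by right.
- rewrite h7 t5 ph_v1 => + /nth_l_inj n1.
  have -> : n = 0 by lia.
  move/(moved_nth w_size w_uniq cov sp rg) => pa.
  have ia : isinner (src a) by rewrite -(cover_fin cov) pa //; lia.
  have [m /andP[m1 m2]] := split_high sp ia X_src_a.
  by rewrite pa; [move/nth_w_inj; lia | lia].
- by rewrite t7 /ph tgt_h_pinfty.
- by left.
Qed.

(** The changed edges all meet [v0], [v1] or the side of the single points, so the
    form of every pair but the first is inherited. *)
Lemma low_fixed x e : isinner x -> X x -> x != v0 -> x != v1 -> @inc R f e x -> e \in U.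
Proof.
move=> ix Xx n0 n1; pattern e; apply: (@edgeP _ f D) => //.
- rewrite /inc /incident tgt_i [v0 == x]eq_sym (negPf n0) orbF => /eqP h.
  by move: ix; rewrite -h; have [] := cr_leaves D; rewrite isleafN => /negPf->.
- rewrite /inc /incident tgt_j [v1 == x]eq_sym (negPf n1) orbF => /eqP h.
  by move: ix; rewrite -h; have [_] := cr_leaves D; rewrite isleafN => /negPf->.
- by rewrite /inc /incident src_k tgt_k ![_ == x]eq_sym (negPf n0) (negPf n1).
- rewrite /inc /incident src_e12 tgt_e12 [_ == x]eq_sym (negPf n1) /= => /eqP h.
  by move: Xx; rewrite -h (negPf X_v2).
- rewrite /inc /incident tgt_a => /orP[]/eqP h; move: Xx; rewrite -h ?(negPf X_v2) //.
  by rewrite (negPf X_src_a).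
- rewrite /inc /incident src_h => /orP[]/eqP hx; first by move: Xx; rewrite -hx (negPf X_v2).
  by move: ix; rewrite -hx; have [_ _] := cr_leaves D; rewrite isleafN => /negPf->.
Qed.

Lemma twist_Sym (P : {set edge f}) : P \subset U -> (P \in Sym f') = (P \in Sym f).
Proof.
apply: (Sym_unchanged twist_data); [exact: fixed_src|exact: fixed_tgt|exact: fixed_wt|].
exact: (twist_inner D cov).
Qed.

Lemma twist_resolving : resolving f z0 -> resolving f' z.
Proof.
move=> res p /(rg_pairs rg)[n ns ->].
have s0 := split_s sp; have t0 := split_t sp.
have [|n0] := posnP n.
  move=> ->; exists v0, v1; split; [exact: ph_v0 | exact: ph_v1 | apply: Or43].
  exists k, o, e12, a, h; split.
  - exact: twist_in0.
  - by split; [decide_edges NE | exact: twist_out0].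
  - split; first by have [_ _ _ []] := TT.
    by have [_ _ _ [_ _ oE _]] := TT; rewrite /= oE; exact: (@cr_oc1 _ _ D).
  - by split; [decide_edges NE | exact: twist_in1].
  - exact: twist_out1.
have /res[v [v' [pv pv' forms]]] : inl (nth 0%R w n.*2, nth 0%R w n.*2.+1) \in z0.
  by apply/pl; exists n.
have low (x : vert f) m : 1 < m < s.*2 -> phi x = (nth 0%R w m)%:E ->
    [/\ [/\ x != v0, x != v1 & x != v2], ph x = (nth 0%R l m)%:E &
      forall e, (e \in edge_in x) || (e \in edge_out x) -> e \in U].
  move=> hm px; have ne (y : vert f) q : q < s.*2 + t -> phi y = (nth 0%R w q)%:E -> m <> q -> x != y.
    move=> hp py mp; apply/eqP => xy; apply: mp; apply: nth_w_inj => //; first by lia.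
    by rewrite -px -py xy.
  have n0' : x != v0 by apply: (ne _ 0) => //; lia.
  have n1' : x != v1 by apply: (ne _ 1) => //; [lia | exact: phi_v1 | lia].
  have n2' : x != v2 by apply: (ne _ (s.*2 + t).-1) => //; [lia | exact: phi_v2 | lia].
  have ix : isinner x by rewrite -(cover_fin cov) px.
  split=> //.
    by apply/(moved_nth w_size w_uniq cov sp rg) => //; lia.
  move=> e he; apply: (@low_fixed x) => //; last first.
    by move: he; rewrite !inE /inc /incident orbC.
  apply/negPn/negP => nX; have [q /andP[q1 q2]] := split_high sp ix nX.
  by rewrite px => /nth_w_inj; lia.
have [nv qv Uv] : [/\ [/\ v != v0, v != v1 & v != v2], ph v = (nth 0%R l n.*2)%:E &
      forall e, (e \in edge_in v) || (e \in edge_out v) -> e \in U].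
  by apply: low pv; lia.
have [nv' qv' Uv'] : [/\ [/\ v' != v0, v' != v1 & v' != v2], ph v' = (nth 0%R l n.*2.+1)%:E &
      forall e, (e \in edge_in v') || (e \in edge_out v') -> e \in U].
  by apply: low pv'; lia.
have Uin e : e \in @edge_in R f v -> e \in U by move=> he; apply: Uv; rewrite he.
have Uout e : e \in @edge_out R f v -> e \in U by move=> he; apply: Uv; rewrite he orbT.
have Uout' e : e \in @edge_out R f v' -> e \in U by move=> he; apply: Uv'; rewrite he orbT.
have iv := twist_in_other nv; have ov := twist_out_other nv.
have iv' := twist_in_other nv'; have ov' := twist_out_other nv'.
exists v, v'; split; [exact: qv | exact: qv' |].
case: forms => [|||].
- case=> [b1 [b2 [c [d [b3 [[h1 h2] h3 h4 [h5 h6 h7] [h8 h9 h10]]]]]]]; apply: Or41.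
  have U1 : b1 \in U by apply: Uin; rewrite h2 !inE eqxx.
  have U2 : b2 \in U by apply: Uin; rewrite h2 !inE eqxx orbT.
  have Uc : c \in U by apply: Uout; rewrite h3 !inE.
  exists b1, b2, c, d, b3; rewrite iv ov iv' ov'; split.
  - by split.
  - exact: h3.
  - by rewrite /= (fixed_tgt Uc).
  - by split.
  - rewrite /= (fixed_wt U1) (fixed_wt U2) (fixed_wt Uc).
    by rewrite twist_Sym ?set2_sub.
- case=> [b1 [b2 [c [d [b3 [h1 [h2 h3] h4 [h5 h6 h7] [h8 h9 h10]]]]]]]; apply: Or42.
  have U1 : b1 \in U by apply: Uout'; rewrite h7 !inE eqxx.
  have U2 : b2 \in U by apply: Uout'; rewrite h7 !inE eqxx orbT.
  have Uc : c \in U by apply: Uout; rewrite h3 !inE eqxx.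
  exists b1, b2, c, d, b3; rewrite iv ov iv' ov'; split.
  - exact: h1.
  - by split.
  - by rewrite /= (fixed_tgt Uc).
  - by split.
  - rewrite /= (fixed_wt U1) (fixed_wt U2) (fixed_wt Uc).
    by rewrite twist_Sym ?set2_sub.
- case=> [b1 [b2 [c [d [b3 [h1 [h2 h3] [h4 h5] h6 h7]]]]]]; apply: Or43.
  have U2 : b2 \in U by apply: Uout; rewrite h3 !inE eqxx.
  have Uc : c \in U by apply: Uout; rewrite h3 !inE eqxx orbT.
  exists b1, b2, c, d, b3; rewrite /formB_with iv ov iv' ov'.
  by rewrite /= (fixed_tgt U2) (fixed_tgt Uc).
- case=> [b1 [b2 [h1 [h2 h3] [h4 h5] h6]]]; apply: Or44.
  have U1 : b1 \in U by apply: Uout; rewrite inE h2.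
  have U2 : b2 \in U by apply: Uout; rewrite inE h3.
  exists b1, b2; rewrite /even /= !(fixed_src U1, fixed_src U2, fixed_tgt U1, fixed_tgt U2).
  by rewrite (fixed_wt U1) (fixed_wt U2).
Qed.

Section TwistSubgraph.
Variables (SV : {set vert f}) (SE : {set edge f}).
Hypothesis zz : zigzag_subgraph (f := f) z0 SV SE.
Hypothesis e12_SE : e12 \in SE.

(** The fork of [i] and [j] and the edge [k] leave the subgraph to form a tail. *)
Definition tSV : {set vert f} := SV :\: [set v2; src i; src j].
Definition tSE : {set edge f} := SE :\: [set i; j; k].

Lemma k_SE : k \in SE.
Proof. by case: zz => _ _ _ [+ _] _ => /fintype.subsetP/(_ _ k_contr). Qed.

Lemma v012_SV : [/\ v0 \in SV, v1 \in SV & v2 \in SV].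
Proof.
case: zz => inc_ _ _ _ _.
have /andP[h0 h1] := inc_ _ k_SE; have /andP[_ h2] := inc_ _ e12_SE.
by rewrite -src_k -tgt_k -tgt_e12.
Qed.

Lemma h_nSE : h \notin SE.
Proof.
apply/negP => hS; case: zz => _ _ _ _ [/(_ h hS) + _].
have [_ o1 o2] := cr_odd D.
rewrite /even; have [_ _ <-] := balance_old D cov; rewrite oddD o1 o2 => /(_ isT)/contr_old[].
  by case/fixedP=> _ _ _ /eqP.
by apply/eqP; decide_edges NE.
Qed.

Lemma inc_leaf_i e : @inc R f e (src i) -> e = i.
Proof. by move=> he; apply: leaf_uniq he (inc_src i); have [] := cr_leaves D. Qed.
Lemma inc_leaf_j e : @inc R f e (src j) -> e = j.
Proof. by move=> he; apply: leaf_uniq he (inc_src j); have [] := cr_leaves D. Qed.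
Lemma inc_leaf_h e : @inc R f e (tgt h) -> e = h.
Proof. by move=> he; apply: leaf_uniq he (inc_tgt h); have [] := cr_leaves D. Qed.

Lemma tgt_h_nSV : tgt h \notin SV.
Proof.
apply/negP => hSV; have [_ _ v2S] := v012_SV.
case: zz => _ /(_ _ _ hSV v2S) + _ _ _.
case/connectP=> -[|x p] /=.
  by move=> _ e2; have := cover_noloop cov h; rewrite src_h e2 eqxx.
case/andP=> /existsP[e /andP[eS je]] _ _.
have /inc_leaf_h eh : inc e (tgt h).
  by move: je; rewrite /inc /incident => /orP[]/andP[] => [->|_ ->]; rewrite ?orbT.
by move: h_nSE; rewrite -eh eS.
Qed.

Definition tail_rel (e1 e2 : edge f) : bool :=
  [&& e1 \notin SE, e2 \notin SE & [exists x, [&& x \notin SV, inc e1 x & inc e2 x]]].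

Definition twist_rel (e1 e2 : edge f) : bool :=
  [&& e1 \notin tSE, e2 \notin tSE &
    [exists x, [&& x \notin tSV, @inc R f' e1 x & @inc R f' e2 x]]].

Lemma out_compE e e' : (e' \in out_comp SV SE e) = connect tail_rel e e'.
Proof. by rewrite inE. Qed.

Lemma twist_out_compE e e' :
  (e' \in @out_comp R f' tSV tSE e) = connect twist_rel e e'.
Proof. by rewrite inE. Qed.

Lemma tail_rel_sym : connect_sym tail_rel.
Proof.
apply: sym_connect_sym => e1 e2; rewrite /tail_rel andbCA; congr [&& _, _ & _].
by apply: eq_existsb => x; congr (_ && _); exact: andbC.
Qed.

(** [h] is an end attached to the subgraph, so nothing else belongs to its tail. *)
Lemma out_comp_h : out_comp SV SE h = [set h].
Proof.
apply/setP => e; rewrite out_compE finset.in_set1; apply/idP/eqP => [|->]; last exact: connect0.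
move=> c; apply/eqP; apply: (connect_closed (W := pred1 h)) c => [u v /eqP-> |]; last by rewrite /= eqxx.
case/and3P=> _ _ /existsP[x /and3P[nx + vx]].
rewrite /inc /incident src_h => /orP[]/eqP hx.
  by move: nx; rewrite -hx; have [_ _ ->] := v012_SV.
by apply/eqP/inc_leaf_h; rewrite hx.
Qed.

Lemma tail_even_edge (K : {set edge f}) v :
  is_tail K v -> exists e : edge f, [/\ e \in K, inc e v & even e].
Proof.
have dbl n (e : edge f) : wt e = 2 * n -> even e by rewrite /even => ->; rewrite oddM.
case=> n; case: ifP => _.
  case=> {K v} [K v [c [-> _ wc _ cv]]|K v [b1 [b2 [c [u [-> _ _ [_ cv] wc]]]]]|].
  - by exists c; rewrite inE (dbl _ _ wc).
  - exists c; rewrite !inE eqxx orbT (dbl _ _ wc); split=> //.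
    by move: cv; rewrite /join /joins /inc /incident => /orP[]/andP[] => [_ ->|->]; rewrite ?orbT.
  - move=> K u b1 b2 c u' v _ _ _ _ _ _ cv wc.
    exists c; rewrite !inE eqxx !orbT (dbl _ _ wc); split=> //.
    by move: cv; rewrite /join /joins /inc /incident => /orP[]/andP[] => [_ ->|->]; rewrite ?orbT.
case=> [[c [-> _ wc _ cv]]|[b1 [b2 [c [u [-> _ _ [_ cv] wc]]]]]].
- by exists c; rewrite inE (dbl _ _ wc).
- exists c; rewrite !inE eqxx orbT (dbl _ _ wc); split=> //.
  by move: cv; rewrite /join /joins /inc /incident => /orP[]/andP[] => [_ ->|->]; rewrite ?orbT.
Qed.

(** A tail is attached along an edge of even weight, and the only such edge at
    [v2] forms a tail by itself. *)
Lemma a_SE : a \in SE.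
Proof.
apply/negPn/negP => aS; case: zz => _ _ _ _ [_ /(_ a aS)[v [/setP hv tl]]].
have [_ _ v2S] := v012_SV.
have /eqP vE : v2 == v.
  have := hv v2; rewrite !inE v2S /= => <-; apply/existsP; exists a.
  by rewrite out_compE connect0 /= -tgt_a inc_tgt.
have [e [eK ev ee]] := tail_even_edge tl.
have [_ o1 o2] := cr_odd D.
have eh : e = h.
  move: ev; rewrite -vE /inc /incident src2 tgt2 => /orP[/eqP //|/orP[]/eqP e_];
    by move: ee; rewrite /even e_ ?o1 ?o2.
move: eK; rewrite out_compE eh tail_rel_sym -out_compE out_comp_h finset.in_set1.
by apply/negP; decide_edges NE.
Qed.

Lemma tSV_P x : x \in tSV = [&& x \in SV, x != v2, x != src i & x != src j].
Proof. by rewrite !inE !negb_or andbC -!andbA. Qed.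

Lemma tSE_P e : e \in tSE = [&& e \in SE, e != i, e != j & e != k].
Proof. by rewrite !inE !negb_or andbC -!andbA. Qed.

Lemma v01_tSV : v0 \in tSV /\ v1 \in tSV.
Proof.
have [h0 h1 _] := v012_SV; have [li lj _] := cr_leaves D.
rewrite !tSV_P h0 h1 (v0v2 D cov) (v1v2 D cov) /=.
by rewrite ![_ == src _]eq_sym !leaf_neq ?inner0 ?inner1.
Qed.

Lemma inc_twist_other (x : vert f) (e : edge f) : x \notin SV -> @inc R f' e x = @inc R f e x.
Proof.
have [h0 h1 h2] := v012_SV => xS.
have nx : [/\ x != v0, x != v1 & x != v2].
  by split; apply: contraNneq xS => ->.
by rewrite /inc /incident /= (tsrc_other cov) // (ttgt_other cov).
Qed.

Lemma inc_twist_leaf (x : vert f) (e : edge f) : isleaf x -> @inc R f' e x = @inc R f e x.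
Proof.
move=> lx; have nx : [/\ x != v0, x != v1 & x != v2].
  by split; apply: leaf_neq => //; [exact: inner0 | exact: inner1 | exact: inner2].
by rewrite /inc /incident /= (tsrc_other cov) // (ttgt_other cov).
Qed.

(* The edges which lie outside of both subgraphs and do not belong to the new
   tail. *)
Let W : pred (edge f) := fun e => (e \notin SE) && (e \notin [set i; j; k]).

(** The old and the new graph only differ at [v0], [v1] and [v2].  Of these only
    [v2] is outside of the new subgraph, and there all edges belong to the new
    tail, so the components of the other edges are the old ones. *)
Lemma tail_rel_W e1 e2 : W e1 -> tail_rel e1 e2 -> W e2.
Proof.
rewrite /W !inE !negb_or => /andP[n1 /andP[/andP[n1i n1j] n1k]].
case/and3P=> _ n2 /existsP[x /and3P[nx x1 x2]]; have [h0 h1 h2] := v012_SV.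
rewrite n2 /=; apply/andP; split; last by apply: contraNneq n2 => ->; exact: k_SE.
apply/andP; split.
  apply: contraNneq n1i => e2i; move: x2; rewrite e2i {1}/inc /incident tgt_i => /orP[]/eqP xE.
    by apply/eqP/inc_leaf_i; rewrite xE.
  by move: nx; rewrite -xE h0.
apply: contraNneq n1j => e2j; move: x2; rewrite e2j {1}/inc /incident tgt_j => /orP[]/eqP xE.
  by apply/eqP/inc_leaf_j; rewrite xE.
by move: nx; rewrite -xE h1.
Qed.

Lemma twist_rel_W e1 e2 : W e1 -> twist_rel e1 e2 = tail_rel e1 e2.
Proof.
move=> We1; have := We1; rewrite /W !inE !negb_or => /andP[n1 /andP[/andP[n1i n1j] n1k]].
have [li lj _] := cr_leaves D; have [h0 h1 h2] := v012_SV.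
apply/idP/idP; last first.
  move=> r12; have := tail_rel_W We1 r12; rewrite /W => /andP[n2 _].
  case/and3P: r12 => _ _ /existsP[x /and3P[nx x1 x2]].
  rewrite /twist_rel !tSE_P (negPf n1) (negPf n2) /=; apply/existsP; exists x.
  by rewrite tSV_P (negPf nx) /= !inc_twist_other // x1.
case/and3P=> _ n2 /existsP[x /and3P[nx x1 x2]].
have xS : x \notin SV.
  apply: contra nx => xS; rewrite tSV_P xS /=; apply/and3P; split.
  - apply/eqP => xE; move: x1; rewrite xE /inc /incident /= (tsrc2 D cov) (ttgt2 D cov).
    by rewrite (negPf n1i) (negPf n1j) (negPf n1k).
  - apply/eqP => xE; move: x1; rewrite xE inc_twist_leaf // => /inc_leaf_i e1i.
    by move: n1i; rewrite e1i eqxx.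
  - apply/eqP => xE; move: x1; rewrite xE inc_twist_leaf // => /inc_leaf_j e1j.
    by move: n1j; rewrite e1j eqxx.
move: x1 x2; rewrite !inc_twist_other // => x1 x2.
rewrite /tail_rel n1 /=; apply/andP; split; last by apply/existsP; exists x; rewrite xS x1.
apply: contra n2 => e2S; rewrite tSE_P e2S /=; apply/and3P; split; apply/eqP => e2E.
- move: x2; rewrite e2E {1}/inc /incident tgt_i => /orP[]/eqP xE.
    by move: n1i; rewrite (@inc_leaf_i e1) ?eqxx // xE.
  by move: xS; rewrite -xE h0.
- move: x2; rewrite e2E {1}/inc /incident tgt_j => /orP[]/eqP xE.
    by move: n1j; rewrite (@inc_leaf_j e1) ?eqxx // xE.
  by move: xS; rewrite -xE h1.
- move: x2; rewrite e2E {1}/inc /incident src_k tgt_k => /orP[]/eqP xE;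
    by move: xS; rewrite -xE ?h0 ?h1.
Qed.

Lemma twist_out_comp_W e : W e -> @out_comp R f' tSV tSE e = out_comp SV SE e.
Proof.
move=> We; apply/setP => e'; rewrite out_compE twist_out_compE.
by apply: (connect_closed_eq (W := W)) => // u v; [exact: twist_rel_W | exact: tail_rel_W].
Qed.

Lemma twist_out_comp_cross e : e \in [set i; j; k] ->
  @out_comp R f' tSV tSE e = [set i; j; k].
Proof.
have [h1 h2 h3 [h4 h5 h6 h7]] := TS; have [t1 t2 t3 [t4 t5 t6 t7]] := TT.
have [li lj _] := cr_leaves D.
have v2n : v2 \notin tSV by rewrite tSV_P eqxx andbF.
have nS b : b \in [set i; j; k] -> b \notin tSE by rewrite !inE => ->.
have at2 b : (b \in [set i; j; k]) = @inc R f' b v2.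
  by rewrite /inc /incident /= (tsrc2 D cov) (ttgt2 D cov) !inE orbC.
have step b b' : b \in [set i; j; k] -> b' \in [set i; j; k] -> twist_rel b b'.
  move=> hb hb'; rewrite /twist_rel !nS //=; apply/existsP; exists v2.
  by rewrite v2n -!at2 hb.
move=> he; apply/setP => e'; rewrite twist_out_compE; apply/idP/idP => [c|he']; last first.
  exact/connect1/step.
apply: (connect_closed (W := mem [set i; j; k])) c => // u v uK.
case/and3P=> _ _ /existsP[x /and3P[nx ux vx]].
have [x0 x1] := v01_tSV.
have [xE|[xE|xE]] : x = v2 \/ x = src i \/ x = src j.
  move: uK ux; rewrite !inE => /orP[/orP[]|]/eqP->; rewrite /inc /incident /=.
  - by rewrite h4 t1 => /orP[]/eqP<-; [right; left | left].
  - by rewrite h5 t2 => /orP[]/eqP<-; [right; right | left].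
  - rewrite h1 t3 => /orP[]/eqP xE; first by left.
    by move: nx; rewrite -xE x0.
- by rewrite /= at2 -xE.
- by move: vx; rewrite xE inc_twist_leaf // => /inc_leaf_i->; rewrite !inE eqxx.
- by move: vx; rewrite xE inc_twist_leaf // => /inc_leaf_j->; rewrite !inE eqxx orbT.
Qed.

Lemma twist_tail_cross : @is_tail R f' [set i; j; k] v0.
Proof.
have [h1 h2 h3 [h4 h5 h6 h7]] := TS; have [t1 t2 t3 [t4 t5 t6 t7]] := TT.
have [w1 w2 w3 [w4 w5 w6 w7]] := TW; have [oi _ _] := cr_odd D.
have [li lj _] := cr_leaves D.
have endi : @isend R f' i.
  by rewrite isendE !twist_isinner /= h4 t1; move: li; rewrite isleafN => /negPf->.
have endj : @isend R f' j.
  by rewrite isendE !twist_isinner /= h5 t2; move: lj; rewrite isleafN => /negPf->.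
exists (wt i); rewrite oi; apply: chain_fork; exists i, j, k, v2; split=> //=.
- split=> //; rewrite inE; apply/existsP; exists i; apply/existsP; exists j.
  apply/existsP; exists v2; rewrite eqxx endi endj twist_isinner inner2 /= w1 w2 eqxx.
  rewrite /inc /incident /= t1 t2 !eqxx !orbT !andbT.
  by decide_edges NE.
- by rewrite twist_isinner inner2 /inc /incident /= t1 t2 !eqxx !orbT.
- split; last by rewrite /join /joins /= h1 t3 !eqxx.
  by rewrite isendE !twist_isinner /= h1 t3 inner0 inner2.
- by rewrite w4 -mul2n.
Qed.

Lemma twist_tail_h : @is_tail R f' [set h] v1.
Proof.
have [_ _ h3 _] := TS; have [_ _ _ [_ _ _ t7]] := TT; have [_ _ _ [_ _ _ w7]] := TW.
have [_ _ lh] := cr_leaves D; have [_ o1 o2] := cr_odd D.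
have [_ _ wh] := balance_old D cov.
have et : @end_tail R f' (wt h)./2 [set h] v1.
  exists h; split=> //=.
  - by rewrite isendE !twist_isinner /= t7; move: lh; rewrite isleafN => /negPf->; rewrite andbF.
  - rewrite w7 mul2n -[LHS]odd_double_half -wh oddD o1 o2; lia.
  - by rewrite twist_isinner inner1.
  - by rewrite /inc /incident /= h3 eqxx.
by exists (wt h)./2; case: ifP => _; [apply: chain_end | left].
Qed.

Lemma twist_tails e : e \notin tSE -> exists v,
  [set x in tSV | [exists e' in @out_comp R f' tSV tSE e, @inc R f' e' x]] = [set v] /\
  @is_tail R f' (@out_comp R f' tSV tSE e) v.
Proof.
have [h1 h2 h3 [h4 h5 h6 h7]] := TS; have [t1 t2 t3 [t4 t5 t6 t7]] := TT.
have [li lj lh] := cr_leaves D; have [h0S h1S] := v01_tSV.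
have [ek|nk] := boolP (e \in [set i; j; k]).
  move=> _; rewrite twist_out_comp_cross //; exists v0; split; last exact: twist_tail_cross.
  apply/setP => x; rewrite [RHS]finset.in_set1 inE; apply/andP/eqP => [[xS]|->]; last first.
    split=> //; apply/existsP; exists k.
    by rewrite !inE eqxx orbT /inc /incident /= t3 eqxx orbT.
  case/existsP=> b /andP[bK]; move: bK xS; rewrite tSV_P !inE.
  case/orP=> [/orP[]|]/eqP-> /and4P[_ x2 xi xj]; rewrite /inc /incident /=.
  - by rewrite h4 t1 ![_ == x]eq_sym (negPf xi) (negPf x2).
  - by rewrite h5 t2 ![_ == x]eq_sym (negPf xj) (negPf x2).
  - by rewrite h1 t3 [v2 == x]eq_sym (negPf x2) /= => /eqP.
move=> etS; have eS : e \notin SE.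
  by apply: contra etS => eS; rewrite tSE_P eS; move: nk; rewrite !inE !negb_or -andbA.
have We : W e by rewrite /W eS nk.
rewrite twist_out_comp_W //.
have [->|neh] := eqVneq e h.
  rewrite out_comp_h; exists v1; split; last exact: twist_tail_h.
  apply/setP => x; rewrite [RHS]finset.in_set1 inE; apply/andP/eqP => [[xS]|->]; last first.
    by split=> //; apply/existsP; exists h; rewrite finset.in_set1 eqxx /inc /incident /= h3 eqxx.
  case/existsP=> b /andP[/set1P->]; rewrite /inc /incident /= h3 t7 => /orP[]/eqP // xE.
  by move: xS; rewrite -xE tSV_P (negPf tgt_h_nSV).
have KU b : b \in out_comp SV SE e -> b \in U.
  move=> bK; have Wb : W b.
    by move: bK; rewrite out_compE; apply: connect_closed We => u v; exact: tail_rel_W.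
  move: Wb; rewrite /W !inE !negb_or => /andP[bS /andP[/andP[bi bj] bk]].
  rewrite bi bj bk /=; apply/andP; split; first (apply/andP; split).
  - by apply: contraNneq bS => ->.
  - by apply: contraNneq bS => ->; exact: a_SE.
  - apply: contraNneq neh => bh; move: bK; rewrite bh out_compE tail_rel_sym -out_compE.
    by rewrite out_comp_h finset.in_set1.
case: zz => _ _ _ _ [_ /(_ e eS)[v [hv tl]]]; exists v; split.
  rewrite -hv; apply/setP => x; rewrite [LHS]finset.in_set [RHS]finset.in_set tSV_P.
  have -> : [exists e' in out_comp SV SE e, @inc R f' e' x] =
            [exists e' in out_comp SV SE e, @inc R f e' x].
    apply: eq_existsb => b; case: (boolP (b \in _)) => //= /KU bU.
    by rewrite /inc /incident /= fixed_src // fixed_tgt.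
  case: (boolP [exists e' in _, _]); rewrite ?andbF ?andbT //.
  case/existsP=> b /andP[/KU bU bx]; case: (boolP (x \in SV)) => //= xS.
  have /fixedP[[bi bj bk] b12 ba bh] := bU.
  apply/and3P; split; apply/eqP => xE; move: bx; rewrite xE.
  - by rewrite /inc /incident src2 tgt2 (negPf bh) (negPf b12) (negPf ba).
  - by move/inc_leaf_i => bE; move: bi; rewrite bE eqxx.
  - by move/inc_leaf_j => bE; move: bj; rewrite bE eqxx.
apply: (is_tail_unchanged twist_data (U := U)) tl.
- exact: fixed_src.
- exact: fixed_tgt.
- exact: fixed_wt.
- exact: (twist_inner D cov).
- by apply/fintype.subsetP.
Qed.

(** A pair in [Sym2] of the new cover avoids the contractible edge [e12], that is,
    all edges at [v0] and [v1].  If it is not the new fork, it then consists of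
    unchanged edges and was already in [Sym2] before. *)
Lemma twist_disjoint : [disjoint tSE & finset.cover (@Sym2 R f' z)].
Proof.
have [h1 h2 h3 [h4 h5 h6 h7]] := TS; have [t1 t2 t3 [t4 t5 t6 t7]] := TT.
have [li lj lh] := cr_leaves D.
apply/pred0P => e /=; apply/negP => /andP[eS /bigcupP[P P2 eP]].
have /and3P[PS /pred0P Pc Pa] : [&& P \in Sym f', [disjoint P & contr f' z] & ~~ @adj_contr R f' z P].
  by rewrite -Sym2E.
have far p x : p \in P -> @inc R f' p x -> @inc R f' e12 x -> False.
  move=> pP px cx; move/negP: Pa; apply; apply/existsP; exists p; rewrite pP /=.
  by apply/existsP; exists e12; rewrite e12_contr /=; apply/existsP; exists x; apply/andP; split; [exact: px | exact: cx].
have far0 p : p \in P -> ~ @inc R f' p v0.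
  by move=> pP px; apply: far pP px _; rewrite /inc /incident /= h2 eqxx.
have far1 p : p \in P -> ~ @inc R f' p v1.
  by move=> pP px; apply: far pP px _; rewrite /inc /incident /= t4 eqxx orbT.
have nPk : k \notin P.
  by apply/negP => /far0; apply; rewrite /inc /incident /= t3 eqxx orbT.
have nP12 : e12 \notin P.
  by apply/negP => /far0; apply; rewrite /inc /incident /= h2 eqxx.
have nPa : a \notin P.
  by apply/negP => /far1; apply; rewrite /inc /incident /= t5 eqxx orbT.
have nPh : h \notin P.
  by apply/negP => /far1; apply; rewrite /inc /incident /= h3 eqxx.
have crossing_fork q : (q == i) || (q == j) -> q \notin P.
  move=> qij; apply/negP => qP.
  have q2 : @ttgt R f D q = v2 by apply/eqP; rewrite (ttgt2 D cov).
  have lq : isleaf (tsrc D q) by case/orP: qij => /eqP->; rewrite ?h4 ?h5.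
  have endq : @isend R f' q.
    by rewrite isendE !twist_isinner /=; move: lq; rewrite isleafN => /negPf->.
  have only x p : @isinner R f' x -> @inc R f' q x -> p \in P -> @inc R f' p x ->
      (p == i) || (p == j).
    move=> ix; rewrite {1}/inc /incident /= q2 => /orP[/eqP xE|/eqP <- pP].
      by move: ix lq; rewrite twist_isinner -xE isleafN => ->.
    rewrite /inc /incident /= (tsrc2 D cov) (ttgt2 D cov) => /orP[/eqP pk|//].
    by move: nPk; rewrite -pk pP.
  have : (e == i) || (e == j).
    move: PS; rewrite finset.in_setU => /orP[].
      rewrite inE => /existsP[b1 /existsP[b2 /and5P[/eqP PE _ n1 n2 _]]].
      by move: qP; rewrite PE !inE => /orP[]/eqP qE; move: endq; rewrite qE ?(negPf n1) ?(negPf n2).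
    rewrite inE => /existsP[b1 /existsP[b2 /existsP[x]]].
    case/and5P=> /eqP PE _ _ _ /and4P[_ ix x1 x2].
    have allx p : p \in P -> @inc R f' p x by rewrite PE !inE => /orP[]/eqP->.
    by apply: (only x) => //; exact: allx.
  by move: eS; rewrite tSE_P => /and4P[_ /negPf-> /negPf->].
have PU : P \subset U.
  apply/fintype.subsetP => p pP; apply/fixedP; split; first split.
  - by apply: contraTneq pP => ->; apply: crossing_fork; rewrite eqxx.
  - by apply: contraTneq pP => ->; apply: crossing_fork; rewrite eqxx orbT.
  - by apply: contraTneq pP => ->.
  - by apply: contraTneq pP => ->.
  - by apply: contraTneq pP => ->.
  - by apply: contraTneq pP => ->.
case: zz => _ _ /pred0P/(_ e) + _ _; move/negbT/negP; apply; apply/andP; split.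
  by move: eS; rewrite tSE_P => /andP[].
apply/bigcupP; exists P => //; rewrite (@Sym2E R f) -twist_Sym // PS /=.
apply/andP; split.
  apply/pred0P => p /=; apply/negP => /andP[pP pc].
  have /negbT/negP := Pc p; apply; apply/andP; split=> //.
  by change (is_true (p \in contr f' z)); rewrite contr_fixed // (fintype.subsetP PU).
apply/negP => /existsP[p /andP[pP /existsP[c /andP[cc /existsP[x /andP[px cx]]]]]].
have pU := fintype.subsetP PU _ pP.
have incU b : b \in U -> @inc R f' b x = @inc R f b x.
  by move=> bU; rewrite /inc /incident /= fixed_src // fixed_tgt.
case: (contr_old cc) => [cU|cE].
  move/negP: Pa; apply; apply/existsP; exists p; rewrite pP /=.
  apply/existsP; exists c; rewrite contr_fixed // cc /=.
  apply/existsP; exists x; apply/andP; split.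
    by have := incU _ pU; rewrite /inc => ->.
  by have := incU _ cU; rewrite /inc => ->.
have /fixedP[[ni nj nk] n12 na nh] := pU.
move: cx px; rewrite cE /incident src_k tgt_k => /orP[]/eqP <-.
  rewrite src0 tgt0 (negPf nk) (negPf ni) !orbF => /eqP po.
  by apply: (far0 p pP); rewrite /inc /incident /= po h6 eqxx.
by rewrite src1 tgt1 (negPf nk) (negPf nj) (negPf n12).
Qed.

Lemma twist_subgraph_connected x y : x \in tSV -> y \in tSV ->
  connect (@adj R f' tSE) x y.
Proof.
have [h1 h2 h3 [h4 h5 h6 h7]] := TS; have [t1 t2 t3 [t4 t5 t6 t7]] := TT.
have [li lj lh] := cr_leaves D.
pose r := fingraph.root (adj_in sr tg tSE).
have st e : e \in tSE -> r (sr e) = r (tg e) by exact: twist_step.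
(* A retraction of the old subgraph onto the vertices of the new one which maps
   the end points of each old edge to connected vertices. *)
pose p x := if x == v2 then v1 else if (x == src i) || (x == src j) then v0 else x.
have s12 : r v0 = r v1.
  rewrite -h2 -t4; apply: st; rewrite tSE_P e12_SE /=; by decide_edges NE.
have sa : r (src a) = r v1.
  rewrite -h7 -t5; apply: st; rewrite tSE_P a_SE /=; by decide_edges NE.
have pin u : isinner u -> u != v2 -> p u = u.
  move=> iu u2; rewrite /p (negPf u2) [u == src i]eq_sym [u == src j]eq_sym.
  by rewrite !(negPf (leaf_neq _ iu)).
have pout u e : e != i -> e != j -> inc e u -> u != v2 -> p u = u.
  move=> ei_ ej_ eu u2; rewrite /p (negPf u2); case: ifP => // /orP[]/eqP uE.
    by move: ei_; rewrite (@inc_leaf_i e) ?eqxx // -uE.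
  by move: ej_; rewrite (@inc_leaf_j e) ?eqxx // -uE.
have p2 : p v2 = v1 by rewrite /p eqxx.
have p0 : p v0 = v0 by apply: pin; [exact: inner0 | exact: v0v2 cov].
have p1 : p v1 = v1 by apply: pin; [exact: inner1 | exact: v1v2 cov].
have pi : p (src i) = v0 by rewrite /p (negPf (leaf_neq li (inner2 D))) eqxx.
have pj : p (src j) = v0 by rewrite /p (negPf (leaf_neq lj (inner2 D))) eqxx orbT.
have old e : e \in SE -> r (p (src e)) = r (p (tgt e)).
  pattern e; apply: (@edgeP _ f D).
  - by rewrite tgt_i pi p0.
  - by rewrite tgt_j pj p1.
  - by rewrite src_k tgt_k p0 p1.
  - by rewrite src_e12 tgt_e12 p1 p2.
  - move=> _; rewrite tgt_a p2 (@pout _ a) ?inc_src //; try by decide_edges NE.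
    by rewrite src2; decide_edges NE.
  - by move=> hS; move: h_nSE; rewrite hS.
  - move=> eU eS; have /fixedP[[ni nj nk] n12 na nh] := eU.
    rewrite !(@pout _ e) ?inc_src ?inc_tgt // ?src2 ?tgt2 ?(negPf n12) //.
    rewrite -{1}(fixed_src eU) -(fixed_tgt eU); apply: st.
    by rewrite tSE_P eS ni nj nk.
have pid u : u \in tSV -> p u = u.
  by rewrite tSV_P /p => /and4P[_ /negPf-> /negPf-> /negPf->].
move=> xS yS; apply/(fingraph.rootP (twist_adj_sym D tSE)); rewrite -/r -(pid x) // -(pid y) //.
have xS' : x \in SV by move: xS; rewrite tSV_P => /andP[].
have yS' : y \in SV by move: yS; rewrite tSV_P => /andP[].
case: zz => _ /(_ _ _ xS' yS')/connectP[q + +] _ _ _.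
elim: q {xS xS'} x => [|u q IH] x /= => [_ ->|] //.
case/andP=> /existsP[e /andP[eS /orP[]/andP[/eqP <- /eqP <-]]] hq hl.
  by rewrite old //; apply: IH.
by rewrite -old //; apply: IH.
Qed.

Lemma twist_zigzag_subgraph : @zigzag_subgraph R f' z tSV tSE.
Proof.
have [h1 h2 h3 [h4 h5 h6 h7]] := TS; have [t1 t2 t3 [t4 t5 t6 t7]] := TT.
have [w1 w2 w3 [w4 w5 w6 w7]] := TW; have [_ o1 o2] := cr_odd D.
have [v0S v1S] := v01_tSV.
case: (zz) => ends _ _ [csub _] [par _].
split.
- move=> e; rewrite tSE_P => /and4P[eS ni nj nk]; move: eS ni nj nk.
  pattern e; apply: (@edgeP _ f D) => /=; rewrite ?eqxx //.
  + by rewrite h2 t4 v0S v1S.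
  + move=> aS _ _ _; rewrite h7 t5 v1S andbT tSV_P; have /andP[-> _] := ends _ aS.
    rewrite src2 /=; apply/and3P; split; first by decide_edges NE.
      by apply/eqP => aE; have := inc_src a; rewrite aE => /inc_leaf_i/eqP; decide_edges NE.
    by apply/eqP => aE; have := inc_src a; rewrite aE => /inc_leaf_j/eqP; decide_edges NE.
  + by move=> hS; move: h_nSE; rewrite hS.
  + move=> eU eS ni nj nk; have /fixedP[_ n12 na nh] := eU.
    rewrite fixed_src // fixed_tgt // !tSV_P; have /andP[-> ->] := ends _ eS.
    rewrite src2 tgt2 nh (negPf n12) na /=.
    have li u : @inc R f e u -> u != src i.
      by move=> eu; apply: contraNneq ni => uE; apply/eqP/inc_leaf_i; rewrite -uE.
    have lj u : @inc R f e u -> u != src j.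
      by move=> eu; apply: contraNneq nj => uE; apply/eqP/inc_leaf_j; rewrite -uE.
    by rewrite !(li, lj) ?inc_src ?inc_tgt.
- exact: twist_subgraph_connected.
- exact: twist_disjoint.
- split; last by exists v1 => //; rewrite twist_isinner inner1.
  apply/fintype.subsetP => e ec_; rewrite tSE_P; case: (contr_new ec_) => [eU|->].
    have /fixedP[[ni nj nk] _ _ _] := eU; apply/and4P; split; [|exact: ni|exact: nj|exact: nk].
    have : e \in contr f z0 by rewrite -contr_fixed.
    by move/(fintype.subsetP csub).
  by rewrite e12_SE /=; decide_edges NE.
- split; last exact: twist_tails.
  move=> e; rewrite tSE_P => /and4P[eS ni nj nk]; move: eS ni nj nk.
  pattern e; apply: (@edgeP _ f D) => /=; rewrite ?eqxx //.
  + by rewrite e12_contr.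
  + by rewrite /even /= w6 o2.
  + by move=> hS; move: h_nSE; rewrite hS.
  + move=> eU eS _ _ _; rewrite /even /= fixed_wt // => ev.
    by rewrite contr_fixed //; apply: par.
Qed.

End TwistSubgraph.

Lemma twist_zigzag SV SE : resolving f z0 -> zigzag_subgraph (f := f) z0 SV SE ->
  e12 \in SE -> is_zigzag f' g lambda mu z.
Proof.
move=> res zz e12_SE; split; [exact: twist_is_cover | exact: twist_resolving |].
by exists (tSV SV), (tSE SE); exact: twist_zigzag_subgraph.
Qed.

End TwistCover.

(** * Recovering a cover from its twist *)

Section TwistRigid.
Variables (R : realType) (f1 f2 : weighted_map R) (D1 : crossing f1) (D2 : crossing f2).
Variables (g : nat) (lambda mu : seq nat) (z0 : seq (branch R)).
Hypotheses (cov1 : is_cover f1 g lambda mu z0) (cov2 : is_cover f2 g lambda mu z0).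
Hypothesis same0 : phi (c0 D1) = phi (c0 D2).
Hypothesis same1 : phi (c1 D1) = phi (c1 D2).
Hypothesis same2 : phi (c2 D1) = phi (c2 D2).

(** Isomorphisms between the twists of [f1] and [f2], without the lengths, which
    are determined. *)
Definition twist_map (kV : vert f1 -> vert f2) (kE : edge f1 -> edge f2) : Prop :=
  [/\ bijective kV, bijective kE,
      forall e, tsrc D2 (kE e) = kV (tsrc D1 e) /\ ttgt D2 (kE e) = kV (ttgt D1 e),
      forall x, phi (kV x) = phi x & forall e, twt D2 (kE e) = twt D1 e].

Section Special.
Variables (kV : vert f1 -> vert f2) (kE : edge f1 -> edge f2).
Hypothesis km : twist_map kV kE.

Lemma twist_map_vert x y : isinner x -> isinner y -> phi x = phi y -> kV x = y.
Proof.
case: km => _ _ _ hp _ ix iy xy.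
case: cov2 => _ [_ inj] _ _ _; apply: inj => //; last by rewrite hp.
by rewrite -topredE /= -(cover_fin cov2) hp (cover_fin cov1).
Qed.

(** A map between twisted graphs preserves the special vertices, as it preserves
    the values, and then each special edge, as it is determined by its end
    points, except for the two ends of the fork. *)
Lemma twist_map0 : kV (c0 D1) = c0 D2.
Proof. by apply: twist_map_vert; rewrite ?inner0. Qed.
Lemma twist_map1 : kV (c1 D1) = c1 D2.
Proof. by apply: twist_map_vert; rewrite ?inner1. Qed.
Lemma twist_map2 : kV (c2 D1) = c2 D2.
Proof. by apply: twist_map_vert; rewrite ?inner2. Qed.

Lemma twist_map_k : kE (ek D1) = ek D2.
Proof.
case: km => _ _ /(_ (ek D1))[hs _] _ _; apply/eqP.
by rewrite -(tsrc2 D2 cov2) hs; have [-> _ _ _] := tsrc_E D1 cov1; rewrite twist_map2.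
Qed.

Lemma twist_map_h : kE (eh D1) = eh D2.
Proof.
case: km => _ _ /(_ (eh D1))[hs _] _ _; apply/eqP.
by rewrite -(tsrc1 D2 cov2) hs; have [_ _ -> _] := tsrc_E D1 cov1; rewrite twist_map1.
Qed.

Lemma twist_map_c : kE (ec D1) = ec D2.
Proof.
case: km => _ _ /(_ (ec D1))[hs ht] _ _.
have [_ s12 _ _] := tsrc_E D1 cov1; have [_ _ _ [t12 _ _ _]] := ttgt_E D1 cov1.
have : (kE (ec D1) == eo D2) || (kE (ec D1) == ec D2).
  by rewrite -(tsrc0 D2 cov2) hs s12 twist_map0.
case/orP=> /eqP // ko.
have : (kE (ec D1) == ec D2) || (kE (ec D1) == ea D2).
  by rewrite -(ttgt1 D2 cov2) ht t12 twist_map1.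
by rewrite ko; decide_edges (edges_neq D2 cov2).
Qed.

Lemma twist_map_a : kE (ea D1) = ea D2.
Proof.
case: (km) => _ /bij_inj inj /(_ (ea D1))[_ ht] _ _.
have [_ _ _ [_ t12 _ _]] := ttgt_E D1 cov1.
have : (kE (ea D1) == ec D2) || (kE (ea D1) == ea D2).
  by rewrite -(ttgt1 D2 cov2) ht t12 twist_map1.
case/orP=> /eqP //; rewrite -twist_map_c => /inj/eqP.
by decide_edges (edges_neq D1 cov1).
Qed.

Lemma twist_map_fork e : e = ei D1 \/ e = ej D1 -> kE e = ei D2 \/ kE e = ej D2.
Proof.
case: km => _ _ /(_ e)[_ ht] _ _ eij; have [t1 t2 _ _] := ttgt_E D1 cov1.
have : (kE e == ei D2) || (kE e == ej D2).
  rewrite -(ttgt2 D2 cov2) ht -twist_map2.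
  by case: eij => ->; rewrite ?t1 ?t2.
by case/orP=> /eqP; [left | right].
Qed.

(** The old source of an edge is a special vertex or its new source, and the same
    holds for targets; the old weight of [ek] is [wt ec - wt ei]. *)
Lemma twist_map_iso : kE (ei D1) = ei D2 -> cover_iso f1 f2.
Proof.
case: (km) => bV bE hst hp hw ki; have inj := bij_inj bE.
have kj : kE (ej D1) = ej D2.
  have [] := @twist_map_fork (ej D1) (or_intror erefl); rewrite // -ki => /inj/eqP.
  by decide_edges (edges_neq D1 cov1).
have [sk s12 sh [si sj so sa]] := tsrc_E D1 cov1.
have [sk' s12' sh' [si' sj' so' sa']] := tsrc_E D2 cov2.
have [ti tj tk [t12 ta to th]] := ttgt_E D1 cov1.
have [ti' tj' tk' [t12' ta' to' th']] := ttgt_E D2 cov2.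
have [wi wj wo [wk w12 wa wh]] := twt_E D1 cov1.
have [wi' wj' wo' [wk' w12' wa' wh']] := twt_E D2 cov2.
have kU e : e \in fixed_edges D1 -> kE e \in fixed_edges D2.
  move=> /fixedP[[e1 e2 e3] e4 e5 e6]; apply/fixedP.
  by rewrite -ki -kj -twist_map_k -twist_map_c -twist_map_a -twist_map_h !(inj_eq inj).
apply: (cover_iso_of_shape cov1 cov2 bV bE); split=> // e.
- pattern e; apply: (@edgeP _ f1 D1).
  + by have [] := hst (ei D1); rewrite ki si si'.
  + by have [] := hst (ej D1); rewrite kj sj sj'.
  + by rewrite twist_map_k !src_k twist_map0.
  + by rewrite twist_map_c !src_e12 twist_map1.
  + by have [] := hst (ea D1); rewrite twist_map_a sa sa'.
  + by rewrite twist_map_h !src_h twist_map2.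
  + by move=> eU; have [] := hst e; rewrite (fixed_src eU) (fixed_src (kU e eU)).
- pattern e; apply: (@edgeP _ f1 D1).
  + by rewrite ki !tgt_i twist_map0.
  + by rewrite kj !tgt_j twist_map1.
  + by rewrite twist_map_k !tgt_k twist_map1.
  + by rewrite twist_map_c !tgt_e12 twist_map2.
  + by rewrite twist_map_a !tgt_a twist_map2.
  + by have [] := hst (eh D1); rewrite twist_map_h th th'.
  + by move=> eU; have [] := hst e; rewrite (fixed_tgt eU) (fixed_tgt (kU e eU)).
have Hi : wt (ei D2) = wt (ei D1) by rewrite -wi' -wi -ki hw.
have H12 : wt (ec D2) = wt (ec D1) by rewrite -w12' -w12 -twist_map_c hw.
pattern e; apply: (@edgeP _ f1 D1).
- by rewrite ki.
- by rewrite kj -!cr_wt.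
- rewrite twist_map_k; have [_ b1 _] := balance_old D1 cov1.
  have [_ b2 _] := balance_old D2 cov2; move: b1 b2; rewrite -!cr_wt H12 Hi; lia.
- by rewrite twist_map_c.
- by rewrite twist_map_a -wa' -wa -twist_map_a hw.
- by rewrite twist_map_h -wh' -wh -twist_map_h hw.
- by move=> eU; rewrite -(fixed_wt (kU e eU)) -(fixed_wt eU) hw.
Qed.

(** The ends of the fork are equivalent in the twisted graph, but not in the old
    one. *)
Lemma twist_map_swap : twist_map (kV \o tperm (src (ei D1)) (src (ej D1)))
                                 (kE \o tperm (ei D1) (ej D1)).
Proof.
case: (km) => bV bE hst hp hw.
have [sk s12 sh [si sj so sa]] := tsrc_E D1 cov1.
have [ti tj tk [t12 ta to th]] := ttgt_E D1 cov1.
have [wi wj _ _] := twt_E D1 cov1.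
have [li lj _] := cr_leaves D1.
have v2n x : isleaf x -> x != c2 D1 by move=> lx; apply: leaf_neq lx (inner2 D1).
have spec (x : vert f1) : isleaf x -> [/\ x != c0 D1, x != c1 D1 & x != c2 D1].
  by move=> lx; split; apply: leaf_neq => //; [exact: inner0|exact: inner1|exact: inner2].
split=> [||e|x|e] /=.
- by apply: bij_comp bV (inv_bij (tpermK _ _)).
- by apply: bij_comp bE (inv_bij (tpermK _ _)).
- have [-> ->] := hst (tperm (ei D1) (ej D1) e).
  case: tpermP => [->|->|/eqP n1 /eqP n2].
  + by rewrite si sj ti tj tpermL tpermD ?v2n.
  + by rewrite si sj ti tj tpermR tpermD ?v2n.
  + rewrite !tpermD //; apply/eqP => hE.
    * move/eqP: (esym hE); rewrite (ttgt_other cov1 _ (spec _ li)) => /eqP tE.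
      by move/eqP: n1; apply; apply: (leaf_uniq li); rewrite ?inc_src // -tE inc_tgt.
    * move/eqP: (esym hE); rewrite (ttgt_other cov1 _ (spec _ lj)) => /eqP tE.
      by move/eqP: n2; apply; apply: (leaf_uniq lj); rewrite ?inc_src // -tE inc_tgt.
    * move/eqP: (esym hE); rewrite (tsrc_other cov1 _ (spec _ li)) => /eqP tE.
      by move/eqP: n1; apply; apply: (leaf_uniq li); rewrite ?inc_src // -tE inc_src.
    * move/eqP: (esym hE); rewrite (tsrc_other cov1 _ (spec _ lj)) => /eqP tE.
      by move/eqP: n2; apply; apply: (leaf_uniq lj); rewrite ?inc_src // -tE inc_src.
- rewrite hp; case: tpermP => // ->.
    by rewrite (cover_src_leaf cov1 li) (cover_src_leaf cov1 lj).
  by rewrite (cover_src_leaf cov1 li) (cover_src_leaf cov1 lj).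
- by rewrite hw; case: tpermP => // ->; rewrite wi wj.
Qed.

End Special.

Lemma twist_map_cover_iso kV kE : twist_map kV kE -> cover_iso f1 f2.
Proof.
move=> km; have [] := @twist_map_fork _ _ km (ei D1) (or_introl erefl) => ki.
  exact: twist_map_iso km ki.
apply: (twist_map_iso (twist_map_swap km)); rewrite /= tpermL.
have [] := @twist_map_fork _ _ km (ej D1) (or_intror erefl) => // kj.
case: km => _ /bij_inj inj _ _ _; move: kj; rewrite -ki => /inj/eqP.
by decide_edges (edges_neq D1 cov1).
Qed.

End TwistRigid.

(** * The injection of proper zigzag classes *)

(** The crossing used for the twist is recorded together with what identifies its
    vertices by their values. *)
Definition twisted_copy (R : realType) (s t : nat) (w l : seq R) (f f' : weighted_map R) : Prop :=
  exists (D : crossing f) (X : pred (vert f)) (hV : vert f -> vert f') (hE : edge f -> edge f'),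
    [/\ split_cover s t w (ec D) X /\ phi (c0 D) = (nth 0%R w 0)%:E,
        bijective hV /\ bijective hE,
        forall e, src (hE e) = hV (tsrc D e) /\ tgt (hE e) = hV (ttgt D e),
        forall x, phi (hV x) = relabel w l (phi x) & forall e, wt (hE e) = twt D e].

Lemma twisted_copy_iso (R : realType) g lambda mu s t (w l : seq R) z0 z f1 f2 f1' f2' :
  size w = s.*2 + t -> uniq w -> regrouping s t z l ->
  is_cover f1 g lambda mu z0 -> is_cover f2 g lambda mu z0 ->
  twisted_copy s t w l f1 f1' -> twisted_copy s t w l f2 f2' ->
  cover_iso f1' f2' -> cover_iso f1 f2.
Proof.
move=> w_size w_uniq rg cv1 cv2.
case=> D1 [X1 [hV1 [hE1 [[sp1 q1] [bV1 bE1] st1 p1 w1]]]].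
case=> D2 [X2 [hV2 [hE2 [[sp2 q2] [bV2 bE2] st2 p2 w2]]]].
case=> hV [hE [bV bE st3 p3 w3]].
have [kV hVK kVK] := bV2; have [kE hEK kEK] := bE2.
have bkV : bijective kV by exists hV2.
have bkE : bijective kE by exists hE2.
apply: (twist_map_cover_iso (D1 := D1) (D2 := D2) cv1 cv2 _ _ _
  (kV := kV \o (hV \o hV1)) (kE := kE \o (hE \o hE1))).
- by rewrite q1 q2.
- by rewrite -!src_e12 (split_phi_src sp1) (split_phi_src sp2).
- by rewrite -!tgt_e12 (split_phi_tgt sp1) (split_phi_tgt sp2).
split=> [||e|x|e] /=.
- by apply: bij_comp bkV (bij_comp bV bV1).
- by apply: bij_comp bkE (bij_comp bE bE1).
- have [a1 a2] := st2 (kE (hE (hE1 e))); have [b1 b2 _] := st3 (hE1 e).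
  have [d1 d2] := st1 e; rewrite kEK in a1 a2.
  by split; apply: (can_inj hVK); rewrite kVK -?a1 -?a2 ?b1 ?b2 ?d1 ?d2.
- apply: (relabel_inj w_uniq (rg_uniq rg) (moved_size w_size rg)).
  + exact: (split_values w_size w_uniq cv2 sp2).
  + exact: (split_values w_size w_uniq cv1 sp1).
  + by rewrite -p2 kVK p3 p1.
- by rewrite -w2 kEK w3 w1.
Qed.

Lemma properly_mixed_crossing (R : realType) (f : weighted_map R) g lambda mu s t (w : seq R) :
  size w = s.*2 + t -> uniq w -> (forall m n, m < n < s.*2 + t -> (nth 0%R w m < nth 0%R w n)%R) ->
  is_properly_mixed f g lambda mu s t w ->
  [/\ is_cover f g lambda mu (trivial_distribution s t w),
      resolving f (trivial_distribution s t w) &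
      exists (D : crossing f) X SV SE,
        [/\ split_cover s t w (ec D) X, phi (c0 D) = (nth 0%R w 0)%:E,
            zigzag_subgraph (trivial_distribution s t w) SV SE & ec D \in SE]].
Proof.
move=> w_size w_uniq w_mono [cov res [SV [SE [zz [e12 [[eS odd12 ne] cut v1prime v2data]]]]]].
split=> //.
have [x [y [sep all_xy imx imy]]] := cut.
have [v0 [p0 p1 [i [o [k [j [e' [B odds ends]]]]]]]] := v1prime.
case: v2data => p2 [b1 [b2 [nb inb ob1 ob2]]].
have sp := properly_mixed_split w_size w_uniq ne sep all_xy imx imy p1 p2.
set X := connect _ x in sp.
have [in0 [ok out0] [tk toN] [jk in1] out1] := B.
have e'E : e' = e12.
  by apply/esym/eqP; move/setP/(_ e12): out1; rewrite !inE eqxx => <-.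
rewrite {}e'E in out1 odds B.
have [oi oo ek oj _] := odds; have [ei ej wij] := ends.
have ti : tgt i = v0 by apply/eqP; move/setP/(_ i): in0; rewrite !inE eqxx.
have tj : tgt j = src e12 by apply/eqP; move/setP/(_ j): in1; rewrite !inE eqxx orbT.
have so : src o = v0 by apply/eqP; move/setP/(_ o): out0; rewrite !inE eqxx.
have sk : src k = v0 by apply/eqP; move/setP/(_ k): out0; rewrite !inE eqxx orbT.
have [a [na in2 oa]] : exists a, [/\ a != e12, edge_in (tgt e12) = [set e12; a] & odd (wt a)].
  move/setP/(_ e12): (inb); rewrite !inE eqxx => /esym/orP[]/eqP eb.
    by exists b2; split=> //; [rewrite eb eq_sym | rewrite inb -eb].
  by exists b1; split=> //; [rewrite eb | rewrite inb -eb finset.setUC].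
have inner2 : isinner (tgt e12) by move: ne; rewrite isendE negbK => /andP[].
have [h out2] : exists h, edge_out (tgt e12) = [set h].
  apply/cards1P; move: inner2; rewrite innerE in2 cards2 (eq_sym e12) na.
  by rewrite -[3]/(1 + 2) eqn_add2r.
have sh : src h = tgt e12 by apply/eqP; move/setP/(_ h): out2; rewrite !inE eqxx.
have inner0 : isinner v0 by rewrite innerE in0 out0 cards1 cards2 ok.
have inner1 : isinner (src e12) by move: ne; rewrite isendE negbK => /andP[].
have leaf_i : isleaf (src i) by move: ei; rewrite isendE ti inner0 andbT isleafN.
have leaf_j : isleaf (src j) by move: ej; rewrite isendE tj inner1 andbT isleafN.
have leaf_h : isleaf (tgt h).
  rewrite isleafN; apply/negP => ih; have := cover_lt cov h; rewrite sh p2.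
  have ph : phi (tgt h) \is a fin_num by rewrite (cover_fin cov).
  have [n nw ->] := split_values w_size w_uniq cov sp ph.
  rewrite w_size in nw; rewrite lte_fin; have [<-|nl] := eqVneq n (s.*2 + t).-1.
    by rewrite ltxx.
  have /w_mono : n < (s.*2 + t).-1 < s.*2 + t by move: nl nw; clear; lia.
  by move/ltW; rewrite leNgt => /negPf->.
have Xo : o != a.
  apply: contraNneq (split_tgt sp) => oE.
  have ta : tgt a = tgt e12 by apply/eqP; move/setP/(_ a): in2; rewrite !inE eqxx orbT.
  rewrite -ta -(split_side sp na) -oE so -sk (split_side sp) ?tk ?(split_src sp) //.
  by apply: contraTneq (split_src sp) => kE; rewrite -tk kE (negPf (split_tgt sp)).
exists (Crossing in0 out0 in1 out1 in2 out2 (And3 ok jk na) toN (And3 leaf_i leaf_j leaf_h)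
  wij (And3 oi odd12 oa) Xo), X, SV, SE.
by split.
Qed.

Theorem theorem5p3 (R : realType) (g : nat) (lambda mu : seq nat) (s t : nat)
  (lambda_part : is_partition lambda) (mu_part : is_partition mu)
  (sum_eq : sumn lambda = sumn mu)
  (RH : (2 * s + t + 2 = size lambda + size mu + 2 * g)%N)
  (st_pos : (0 < 2 * s + t)%N)
  (not_special : forall k : nat, (0 < k)%N ->
     ~ (lambda \in [:: [:: (2 * k)%N]; [:: k; k]] /\ mu \in [:: [:: (2 * k)%N]; [:: k; k]]))
  (Lam : seq (seq nat)) (Lam_tuple : is_st_tuple (sumn lambda) s t Lam)
  (z : seq (branch R)) (z_distr : is_distribution s t z)
  (z_compat : compatible (sumn lambda) Lam z)
  (w : seq R) (w_size : size w = (2 * s + t)%N) (w_sorted : sorted (fun a b : R => (a < b)%R) w) :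
  (proper_zigzag_number g lambda mu s t w <= zigzag_number g lambda mu z)%N.
Proof.
rewrite mul2n in w_size.
have w_uniq : uniq w by apply: lt_sorted_uniq w_sorted.
have w_mono m n : m < n < s.*2 + t -> (nth 0%R w m < nth 0%R w n)%R.
  move=> /andP[mn nw]; apply: (sorted_ltn_nth lt_trans 0%R w_sorted) => //.
    by rewrite inE w_size (ltn_trans mn).
  by rewrite inE w_size.
have rg := regrouping_regrouped z_distr; set l := regrouped z in rg.
have fin : finite_set (iso_classes [set f | is_zigzag f g lambda mu z]%classic).
  by apply: finite_cover_classes => f [cov _ _]; exact: cov.
have crossing_of := @properly_mixed_crossing R _ g lambda mu s t w w_size w_uniq w_mono.
(* Whether the cut edge keeps its direction only depends on [z]. *)
have [ord|nord] := ltP (nth 0%R l 1) (nth 0%R l (s.*2 + t).-1).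
  apply: (count_classes_le (rel := fun f f' => moved_copy w l f f' /\
    is_properly_mixed f g lambda mu s t w)) fin _ _.
    move=> f pm; have [cov res [D [X [SV [SE [sp _ zz _]]]]]] := crossing_of f pm.
    have [f' [zf' cf']] := moved_zigzag w_size w_uniq w_mono cov sp rg ord res zz.
    by exists f'.
  move=> f1 f2 f1' f2' _ _ [m1 /crossing_of[c1 _ [D1 [X1 [_ [_ [sp1 _ _ _]]]]]]].
  move=> [m2 /crossing_of[c2 _ [D2 [X2 [_ [_ [sp2 _ _ _]]]]]]].
  exact: (moved_copy_iso w_size w_uniq rg c1 c2 sp1 sp2 m1 m2).
apply: (count_classes_le (rel := fun f f' => twisted_copy s t w l f f' /\
  is_properly_mixed f g lambda mu s t w)) fin _ _.
  move=> f pm; have [cov res [D [X [SV [SE [sp q0 zz eS]]]]]] := crossing_of f pm.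
  have s0 := split_s sp; have t0 := split_t sp.
  have rev : (nth 0%R l (s.*2 + t).-1 < nth 0%R l 0)%R.
    have : s.*2 <= (s.*2 + t).-1 < s.*2 + t by move: s0 t0; clear; lia.
    by move/(rg_outside rg s0); rewrite [X in _ || X]ltNge nord orbF.
  exists (built (twist_data w_size w_uniq w_mono cov sp rg q0 rev)); split.
    exact: (twist_zigzag w_size w_uniq w_mono cov sp rg q0 rev res zz eS).
  split=> //; exists D, X, id, id; split=> //.
  by split; exists id.
move=> f1 f2 f1' f2' _ _ [m1 /crossing_of[c1 _ _]] [m2 /crossing_of[c2 _ _]].
exact: (twisted_copy_iso w_size w_uniq rg c1 c2 m1 m2).
Qed.
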